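(* (1) The Bigolin numbers determine the multiplicities of all odd zigzags: if $\mathcal A_1,\mathcal A_2$ are bounded double complexes with finitely many zigzags in their decompositions and $h^k_{p,q}(\mathcal A_1)=h^k_{p,q}(\mathcal A_2)$ for all $p,q,k\in\mathbb Z$, then every odd zigzag has the same multiplicity in $\mathcal A_1$ and in $\mathcal A_2$. (2) For every $n\ge 4$ there exist two double complexes in $\mathrm{DC}^{\mathrm{form}}_n$ with the same Bigolin numbers $h^k_{p,q}$ (for all $p,q,k$) but with different multiplicities of even zigzags.
   Context: A double complex is a bigraded complex vector space $\mathcal A=\bigoplus_{p,q\in\mathbb Z}\mathcal A^{p,q}$ with linear maps $\partial$ of bidegree $(1,0)$ and $\overline\partial$ of bidegree $(0,1)$ such that $\partial^2=\overline\partial^2=\partial\overline\partial+\overline\partial\partial=0$; put $d=\partial+\overline\partial$. It is bounded if $\mathcal A^{p,q}=0$ for $|p|+|q|$ large. A square is a double complex with one copy of $\mathbb C$ in each of the bidegrees $(p,q),(p+1,q),(p,q+1),(p+1,q+1)$, zero elsewhere, with all four maps between these copies isomorphisms. A zigzag of length $1$ (a dot) is a copy of $\mathbb C$ in one bidegree with zero maps. For $k\in\mathbb Z$ consider the path graph on bidegrees of total degree $k$ and $k+1$ in which $(r,s)$ with $r+s=k$ is joined to $(r+1,s)$ and to $(r,s+1)$. A zigzag of length $m\ge2$ is the double complex with one copy of $\mathbb C$ at each of $m$ consecutive vertices of such a path, the maps along edges between these vertices being isomorphisms and all other maps zero. A zigzag is odd or even according to the parity of its length. Every bounded double complex is isomorphic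 to a direct sum of squares and zigzags, with uniquely determined multiplicities. Bigolin numbers: for integers $p,q$ let $\mathcal B^k_{p,q}(\mathcal A)=\bigoplus_{r+s=k,\ r\le p,\ s\le q}\mathcal A^{r,s}$ if $k\le p+q$ and $\mathcal B^k_{p,q}(\mathcal A)=\bigoplus_{r+s=k+1,\ r>p,\ s>q}\mathcal A^{r,s}$ if $k>p+q$. The Bigolin complex $\cdots\to\mathcal B^{k}_{p,q}\to\mathcal B^{k+1}_{p,q}\to\cdots$ has differential $\pi\circ d$ for $k<p+q$ (where $\pi$ is the projection onto $\bigoplus_{r\le p,\,s\le q}\mathcal A^{r,s}$), $\partial\overline\partial:\mathcal A^{p,q}\to\mathcal A^{p+1,q+1}$ for $k=p+q$, and $d$ for $k>p+q$. The Bigolin number $h^k_{p,q}(\mathcal A)$ is the dimension of its cohomology at $\mathcal B^k_{p,q}$. $\mathrm{DC}^{\mathrm{form}}_n$ (double complexes of formal dimension $n$) is the class of double complexes $\mathcal A$ such that: $\mathcal A^{p,q}=0$ unless $0\le p\le n$ and $0\le q\le n$; the only zigzags in the decomposition having a component in one of the corners $(0,0),(n,0),(0,n),(n,n)$ are dots; there are finitely many zigzags in the decomposition; the multiplicities of zigzags are invariant under the reflections $(p,q)\mapsto(q,p)$ and $(p,q)\mapsto(n-q,n-p)$ (a zigzag is sent to the zigzag whose support is the image of its support). *)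

(* Defs.v *)
From HB Require Import structures.
From mathcomp Require Import all_boot all_order all_algebra.
From mathcomp Require Import complex.
From mathcomp Require Import boolp classical_sets functions cardinality fsbigop reals.

Set Implicit Arguments.
Unset Strict Implicit.
Unset Printing Implicit Defensive.

Import Order.TTheory GRing.Theory Num.Theory.

Local Open Scope classical_set_scope.
Local Open Scope card_scope.
Local Open Scope ring_scope.

(* The grading is internal: [carrier] is the total space, possibly of infinite
   dimension, and [bideg (p, q)] is its subspace A^{p,q}.  The field
   [bideg_direct] says that the carrier is the direct sum of these subspaces. *)
Record double_complex (R : realType) := DoubleComplex {
  carrier :> lmodType R[i];
  bideg : int * int -> set carrier;
  del : {linear carrier -> carrier};
  delbar : {linear carrier -> carrier};
  bideg_submod : forall pq, submod_closed [in bideg pq];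
  bideg_direct : forall v : carrier, exists! x : int * int -> carrier,
    [/\ forall pq, bideg pq (x pq),
        finite_set [set pq | x pq != 0] &
        v = \sum_(pq \in [set: int * int]) x pq];
  del_bideg : forall p q v, bideg (p, q) v -> bideg (p + 1, q) (del v);
  delbar_bideg : forall p q v, bideg (p, q) v -> bideg (p, q + 1) (delbar v);
  del_del : forall v, del (del v) = 0;
  delbar_delbar : forall v, delbar (delbar v) = 0;
  del_delbar : forall v, del (delbar v) + delbar (del v) = 0
}.

Arguments bideg {R} _ _ _.
Arguments del {R} _.
Arguments delbar {R} _.

Section DoubleComplexes.
Context {R : realType}.
Implicit Types (A B : double_complex R).

Definition dtot A (v : A) : A := del A v + delbar A v.

Definition component A (v : A) : int * int -> A :=
  sval (cid (bideg_direct v)).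

Definition proj A (S : set (int * int)) (v : A) : A :=
  \sum_(pq \in S) component v pq.

Definition bounded A : Prop :=
  exists N : int, forall p q : int, N < `|p| + `|q| -> bideg A (p, q) = [set 0].

(* dim (Z / Y) = n for subspaces Y of Z: the classes of the e i are a basis. *)
Definition quotient_dim (V : lmodType R[i]) (Z Y : set V) (n : nat) : Prop :=
  exists e : 'I_n -> V, (forall i, Z (e i)) /\
    forall z, Z z -> exists! c : 'I_n -> R[i], Y (z - \sum_i c i *: e i).

Definition bigolin_box (p q : int) : set (int * int) :=
  [set rs | rs.1 <= p /\ rs.2 <= q].

Definition bigolin_region (p q k : int) : set (int * int) :=
  if k <= p + q
  then [set rs | [/\ rs.1 + rs.2 = k, rs.1 <= p & rs.2 <= q]]
  else [set rs | [/\ rs.1 + rs.2 = k + 1, p < rs.1 & q < rs.2]].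

Definition bigolin_space A (p q k : int) : set A :=
  [set v | forall rs, ~ bigolin_region p q k rs -> component v rs = 0].

Definition bigolin_diff A (p q k : int) (v : A) : A :=
  if k < p + q then proj (bigolin_box p q) (dtot v)
  else if k == p + q then del A (delbar A v)
  else dtot v.

Definition bigolin_cocycles A (p q k : int) : set A :=
  [set v | bigolin_space p q k v /\ bigolin_diff p q k v = 0].

Definition bigolin_coboundaries A (p q k : int) : set A :=
  @bigolin_diff A p q (k - 1) @` @bigolin_space A p q (k - 1).

(* [None] stands for infinite dimension. *)
Definition bigolin_number A (p q k : int) : option nat :=
  if pselect (exists n, quotient_dim (@bigolin_cocycles A p q k)
                                     (@bigolin_coboundaries A p q k) n)
    is left h then Some (sval (cid h)) else None.

Definition same_bigolin_numbers A B : Prop :=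
  forall p q k, bigolin_number A p q k = bigolin_number B p q k.

(* One copy of the ground field at each bidegree of S, nothing elsewhere, and
   isomorphisms between adjacent bidegrees of S.  All other maps vanish, since
   their source or their target does. *)
Definition thin (S : set (int * int)) B : Prop :=
  [/\ forall pq, S pq -> quotient_dim (bideg B pq) [set 0] 1,
      forall pq, ~ S pq -> bideg B pq = [set 0],
      forall p q, S (p, q) -> S (p + 1, q) ->
        set_bij (bideg B (p, q)) (bideg B (p + 1, q)) (del B) &
      forall p q, S (p, q) -> S (p, q + 1) ->
        set_bij (bideg B (p, q)) (bideg B (p, q + 1)) (delbar B)].

Definition is_square B : Prop := exists p q : int,
  thin [set (p, q); (p + 1, q); (p, q + 1); (p + 1, q + 1)] B.

(* The path graph on total degrees k and k + 1, enumerated by the integers: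
   2a |-> (a, k - a) and 2a + 1 |-> (a + 1, k - a). *)
Definition path_vertex (k j : int) : int * int :=
  (((j + 1) %/ 2)%Z, k - (j %/ 2)%Z).

(* For m = 1 the supports are all the singletons.  For m >= 2, adjacent
   bidegrees of a support (in the sense of [thin]) are exactly adjacent vertices
   of the path, so that a zigzag is determined by its support up to
   isomorphism. *)
Definition zigzag_support (m : nat) (S : set (int * int)) : Prop :=
  (0 < m)%N /\ exists k j : int, S = [set path_vertex k (j + i%:Z) | i in `I_m].

Definition odd_support (S : set (int * int)) : Prop :=
  exists2 m, odd m & zigzag_support m S.

Definition even_support (S : set (int * int)) : Prop :=
  exists2 m, ~~ odd m & zigzag_support m S.

Definition is_zigzag (S : set (int * int)) B : Prop :=
  (exists m, zigzag_support m S) /\ thin S B.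

(* An isomorphism of A with a direct sum of squares and zigzags, given by its
   restrictions to the summands. *)
Record decomposition A := Decomposition {
  dec_index : choiceType;
  summand : dec_index -> double_complex R;
  summand_inj : forall i, {linear summand i -> A};
  summand_inj_bideg : forall i pq v,
    bideg (summand i) pq v -> bideg A pq (summand_inj i v);
  summand_inj_del : forall i v,
    summand_inj i (del (summand i) v) = del A (summand_inj i v);
  summand_inj_delbar : forall i v,
    summand_inj i (delbar (summand i) v) = delbar A (summand_inj i v);
  dec_direct : forall v : A, exists! x : forall i, summand i,
    finite_set [set i | x i != 0] /\
    v = \sum_(i \in [set: dec_index]) summand_inj i (x i);
  summand_elementary : forall i,
    is_square (summand i) \/ exists S, is_zigzag S (summand i)
}.

(* The multiplicity of the zigzag with support S is the cardinality of this
   set; multiplicities are compared by [#=]. *)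
Definition zigzag_summands A (D : decomposition A) (S : set (int * int)) :
  set (dec_index D) := [set i | is_zigzag S (summand i)].

Arguments zigzag_summands {A} D _ _.

Definition finitely_many_zigzags A (D : decomposition A) : Prop :=
  finite_set [set i : dec_index D | exists S, is_zigzag S (summand i)].

Definition corner (n : int) : set (int * int) :=
  [set (0, 0); (n, 0); (0, n); (n, n)].

Definition transpose_refl (pq : int * int) : int * int := (pq.2, pq.1).

Definition duality_refl (n : int) (pq : int * int) : int * int :=
  (n - pq.2, n - pq.1).

Definition formal_decomposition A (n : int) (D : decomposition A) : Prop :=
  [/\ forall (i : dec_index D) S, is_zigzag S (summand i) ->
        forall pq, S pq -> corner n pq -> zigzag_support 1 S,
      finitely_many_zigzags D,
      forall S, (exists m, zigzag_support m S) ->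
        zigzag_summands D (transpose_refl @` S) #= zigzag_summands D S &
      forall S, (exists m, zigzag_support m S) ->
        zigzag_summands D (duality_refl n @` S) #= zigzag_summands D S].

Definition DCform (n : nat) A : Prop :=
  (forall p q : int, ~ (0 <= p <= n%:Z /\ 0 <= q <= n%:Z) ->
     bideg A (p, q) = [set 0]) /\
  exists D : decomposition A, formal_decomposition n%:Z D.

End DoubleComplexes.

Arguments zigzag_summands {R A} D _ _.

(* Main.v *)
(* Squares have acyclic Bigolin complexes.  On a zigzag the map del delbar
   vanishes, so its Bigolin numbers are the cohomology of its restrictions to the
   quadrants {r <= p, s <= q} and {r > p, s > q}.  Such a restriction is again an
   interval of the path, hence has cohomology (of dimension 1) only if it is odd.
   This gives, for an odd zigzag with data (u, v, D),
     h^D_{p,q} = [u <= p][v <= q]  and  h^{D-1}_{p,q} = [u > p][v > q],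
   while an even zigzag contributes a function of p alone or of q alone.  The
   mixed difference of h^k_{p,q} in p and q thus removes the even zigzags and
   computes N(p+1, q+1, k) + N(p+1, q+1, k+1), N being the multiplicity of odd
   zigzags; downward induction on k recovers N.

   For even zigzags only the number of those covering a given even vertex is
   seen.  Hence a zigzag of length 4 starting at an even vertex has the same
   Bigolin numbers as the two zigzags of length 2 obtained by erasing its middle
   arrow, and the counterexample is the orbit of such a pair under the two
   reflections. *)

Require Import Defs.
From HB Require Import structures.
From mathcomp Require Import all_boot all_order all_algebra.
From mathcomp Require Import finmap complex.
From mathcomp Require Import boolp classical_sets functions cardinality fsbigop reals.
From mathcomp Require Import zify ring.

Set Implicit Arguments.
Unset Strict Implicit.
Unset Printing Implicit Defensive.

Import Order.TTheory GRing.Theory Num.Theory.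

Local Open Scope classical_set_scope.
Local Open Scope card_scope.
Local Open Scope ring_scope.

(** A decomposition may contain infinitely many squares, so dimensions are not simply added: in each
    degree every summand is shown to have cohomology zero or a line, and the Bigolin number of the
    sum counts the lines along a finite list that contains all zigzags. The second part concerns
    arbitrary decompositions, not only those from which the two complexes are built. Multiplicities
    are therefore compared through properties of the complexes themselves that pass to summands.
    Around the arrow from (0, 3) to (1, 3), the image of [del] lies in the image of [delbar] from
    (1, 2) in one complex; in the other, [del] is injective on bidegree (0, 3) and [delbar] vanishes
    on bidegree (1, 2). The bound n >= 4 keeps (0, 3) away from the corner (0, n). *)

Lemma finite_uniq_seq (T : choiceType) (A : set T) :
  finite_set A -> exists2 s : seq T, uniq s & A = [set` s].
Proof.
move=> /finite_seqP[s ->]; exists (undup s); first exact: undup_uniq.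
by apply/seteqP; split=> x /=; rewrite mem_undup.
Qed.

Lemma fsum_seq (T : choiceType) (V : nmodType) (s : seq T) (F : T -> V) :
  uniq s -> (forall i, i \notin s -> F i = 0) ->
  \sum_(i \in [set: T]) F i = \sum_(i <- s) F i.
Proof.
move=> us F0; rewrite (fsbigE s) //; last by move=> i _; exact: F0.
by apply: eq_bigl => i; apply: mem_set.
Qed.

(** * Direct sums *)

Section DirectSum.
Context {K : pzRingType} {V : lmodType K} {I : choiceType}.
Context {U : I -> lmodType K}.
Variable f : forall i, {linear U i -> V}.
Variable W : forall i, set (U i).

(** A common form for the bigrading, where [f] is the identity and [W] the family of bidegrees, and
    for decompositions, where [W] is everything. *)
Definition direct_sum : Prop :=
  (forall i, submod_closed [in W (i := i)]) /\
  forall v : V, exists! x : forall i, U i,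
    [/\ forall i, W (x i), finite_set [set i | x i != 0] &
        v = \sum_(i \in [set: I]) f i (x i)].

Hypothesis fW : direct_sum.

Lemma W0 i : W (0 : U i).
Proof. by have [W0 _] := fW.1 i; rewrite in_setE in W0. Qed.

Lemma W_lin i a (u v : U i) : W u -> W v -> W (a *: u + v).
Proof.
have [_ /= WL] := fW.1 i => Wu Wv.
by have := WL a u v; rewrite !in_setE; apply.
Qed.

Definition coord i (v : V) : U i := sval (cid (fW.2 v)) i.

Lemma coord_in v i : W (coord i v).
Proof. by rewrite /coord; case: cid => x /= [[]]. Qed.

Lemma coord_fin v : finite_set [set i | coord i v != 0].
Proof. by rewrite /coord; case: cid => x /= [[]]. Qed.

Lemma coord_sum v : v = \sum_(i \in [set: I]) f i (coord i v).
Proof. by rewrite /coord; case: cid => x /= [[]]. Qed.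

Lemma coord_unique v (x : forall i, U i) :
  (forall i, W (x i)) -> finite_set [set i | x i != 0] ->
  v = \sum_(i \in [set: I]) f i (x i) -> forall i, coord i v = x i.
Proof.
move=> Wx fx vx i; rewrite /coord; case: cid => y /= [_ /(_ x)].
by move=> ->.
Qed.

Lemma coord_seq v : exists2 s : seq I, uniq s &
  (forall i, i \notin s -> coord i v = 0) /\ v = \sum_(i <- s) f i (coord i v).
Proof.
have [s us Es] := finite_uniq_seq (coord_fin v).
have s0 i : i \notin s -> coord i v = 0.
  move=> /negP; rewrite -[i \in s : Prop]/([set` s] i) -Es /=.
  by case: eqVneq.
exists s => //; split=> //; rewrite [LHS]coord_sum; apply: fsum_seq => //.
by move=> i /s0 ->; rewrite linear0.
Qed.

Lemma coord_sum_seq (s : seq I) (x : forall i, U i) : uniq s ->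
  (forall i, W (x i)) -> (forall i, i \notin s -> x i = 0) ->
  forall i, coord i (\sum_(i <- s) f i (x i)) = x i.
Proof.
move=> us Wx x0; apply: coord_unique => //.
  apply: (@sub_finite_set _ _ [set` s]); last exact: finite_seq.
  by move=> i /=; apply: contraNT => /x0 ->.
by rewrite (fsum_seq (s := s)) // => i /x0 ->; rewrite linear0.
Qed.

(** Both vectors are expanded along one common finite list of indices; uniqueness of coordinates
    does the rest. *)
Lemma coord_linear i : linear (coord i).
Proof.
move=> a u v.
have [su usu [u0 {1}->]] := coord_seq u; have [sv usv [v0 {1}->]] := coord_seq v.
pose s := undup (su ++ sv).
have us : uniq s by exact: undup_uniq.
have ext w (sw : seq I) : uniq sw -> {subset sw <= s} ->
    (forall i, i \notin sw -> coord i w = 0) ->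
    \sum_(i <- sw) f i (coord i w) = \sum_(i <- s) f i (coord i w).
  move=> usw sws w0; have z i0 : i0 \notin sw -> f i0 (coord i0 w) = 0.
    by move=> /w0 ->; rewrite linear0.
  rewrite -(fsum_seq usw) // -(fsum_seq us) // => j js.
  by apply: z; apply: contra js; exact: sws.
rewrite (ext u su) //; last by move=> j ju; rewrite mem_undup mem_cat ju.
rewrite (ext v sv) //; last by move=> j jv; rewrite mem_undup mem_cat jv orbT.
rewrite scaler_sumr -big_split /=.
under eq_bigr do rewrite -linearP.
rewrite coord_sum_seq // => j; first exact/W_lin/coord_in/coord_in.
rewrite mem_undup mem_cat negb_or => /andP[/u0 -> /v0 ->].
by rewrite scaler0 addr0.
Qed.

HB.instance Definition _ i :=
  GRing.isLinear.Build K V (U i) _ (coord i) (coord_linear i).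

Lemma coord_f i w : W w -> coord i (f i w) = w.
Proof.
(* The family concentrated at [i]. The [U j] are different types, so [w] is transported along a
   proof of [i = j]. *)
pose x j := if pselect (i = j) is left e then ecast j (U j) e w else 0.
have xi : x i = w.
  by rewrite /x; case: pselect => // e; rewrite (Prop_irrelevance e erefl).
have x0 j : i <> j -> x j = 0 by rewrite /x; case: pselect.
move=> Ww; rewrite -{2}xi.
have -> : f i w = \sum_(j <- [:: i]) f j (x j) by rewrite big_seq1 xi.
apply: coord_sum_seq => // j; last by rewrite inE => /eqP ij; exact/x0/nesym.
by case: (pselect (i = j)) => [<-|/x0->]; [rewrite xi|exact: W0].
Qed.

Lemma coord_f0 i j w : W w -> i <> j -> coord j (f i w) = 0.
Proof.
pose x j := if pselect (i = j) is left e then ecast j (U j) e w else 0.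
have xi : x i = w.
  by rewrite /x; case: pselect => // e; rewrite (Prop_irrelevance e erefl).
have x0 j' : i <> j' -> x j' = 0 by rewrite /x; case: pselect.
move=> Ww ij; rewrite -(x0 j ij).
have -> : f i w = \sum_(j <- [:: i]) f j (x j) by rewrite big_seq1 xi.
apply: coord_sum_seq => // k; last by rewrite inE => /eqP ik; exact/x0/nesym.
by case: (pselect (i = k)) => [<-|/x0->]; [rewrite xi|exact: W0].
Qed.

Lemma coord_ext u v : (forall i, coord i u = coord i v) -> u = v.
Proof.
by move=> uv; rewrite [u]coord_sum [v]coord_sum; apply: eq_fsbigr => i _; rewrite uv.
Qed.

Lemma coord_ind (P : V -> Prop) : P 0 -> (forall u v, P u -> P v -> P (u + v)) ->
  (forall i w, W w -> P (f i w)) -> forall v, P v.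
Proof.
move=> P0 PD Pf v; have [s _ [_ ->]] := coord_seq v.
by apply: big_ind => // i _; apply: Pf; exact: coord_in.
Qed.

End DirectSum.

(** * The bigrading *)

Section Graded.
Context {R : realType}.
Implicit Types A : double_complex R.

Lemma bideg_direct_sum A :
  direct_sum (fun=> idfun : {linear A -> A}) (fun pq => bideg A pq).
Proof.
split=> [pq|v]; first exact: bideg_submod.
exact: (bideg_direct v).
Qed.

Lemma componentE A (v : A) pq : component v pq = coord (bideg_direct_sum A) pq v.
Proof.
rewrite /component; case: cid => x /= [[Wx fx vx] _].
by rewrite (coord_unique (bideg_direct_sum A) Wx fx vx).
Qed.

Section A.
Context {A : double_complex R}.
Implicit Types u v : A.

Lemma componentD u v pq : component (u + v) pq = component u pq + component v pq.
Proof. by rewrite !componentE linearD. Qed.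

Lemma componentZ a v pq : component (a *: v) pq = a *: component v pq.
Proof. by rewrite !componentE linearZ. Qed.

Lemma component0 pq : component (0 : A) pq = 0.
Proof. by rewrite !componentE linear0. Qed.

Lemma component_sum J (r : seq J) (F : J -> A) pq :
  component (\sum_(j <- r) F j) pq = \sum_(j <- r) component (F j) pq.
Proof.
by rewrite componentE linear_sum; apply: eq_bigr => j _; rewrite componentE.
Qed.

Lemma component_bideg v pq : bideg A pq (component v pq).
Proof. by rewrite componentE; exact: coord_in. Qed.

Lemma component_ext u v : (forall pq, component u pq = component v pq) -> u = v.
Proof.
by move=> uv; apply: (coord_ext (fW := bideg_direct_sum A)) => pq; rewrite -!componentE.
Qed.

Lemma component_homog pq rs v :
  bideg A pq v -> component v rs = if rs == pq then v else 0.
Proof.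
move=> vpq; rewrite componentE; case: eqVneq => [->|/eqP rspq].
  exact: (coord_f (bideg_direct_sum A)).
exact: (coord_f0 (bideg_direct_sum A) vpq (nesym rspq)).
Qed.

Lemma homog_ind (P : A -> Prop) : P 0 -> (forall u v, P u -> P v -> P (u + v)) ->
  (forall pq v, bideg A pq v -> P v) -> forall v, P v.
Proof. exact: (coord_ind (bideg_direct_sum A)). Qed.

Lemma bideg0 pq : bideg A pq 0.
Proof. exact: (W0 (bideg_direct_sum A)). Qed.

Lemma bidegP pq a u v : bideg A pq u -> bideg A pq v -> bideg A pq (a *: u + v).
Proof. exact: (W_lin (bideg_direct_sum A)). Qed.

Lemma bidegZ pq a u : bideg A pq u -> bideg A pq (a *: u).
Proof. by move=> Au; rewrite -[_ *: _]addr0; apply: bidegP => //; exact: bideg0. Qed.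

Lemma bidegN pq u : bideg A pq u -> bideg A pq (- u).
Proof. by rewrite -scaleN1r; exact: bidegZ. Qed.

Lemma bidegE pq v : bideg A pq v <-> component v pq = v.
Proof.
by split=> [/component_homog ->|<-]; [rewrite eqxx|exact: component_bideg].
Qed.

Lemma component_del v p q : component (del A v) (p, q) = del A (component v (p - 1, q)).
Proof.
elim/homog_ind: v => [|u v IHu IHv|[r s] v vrs].
- by rewrite linear0 !component0 linear0.
- by rewrite linearD !componentD IHu IHv linearD.
rewrite (component_homog _ (del_bideg vrs)) (component_homog _ vrs).
by rewrite !xpair_eqE subr_eq; case: ifP => //; rewrite linear0.
Qed.

Lemma component_delbar v p q :
  component (delbar A v) (p, q) = delbar A (component v (p, q - 1)).
Proof.
elim/homog_ind: v => [|u v IHu IHv|[r s] v vrs].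
- by rewrite linear0 !component0 linear0.
- by rewrite linearD !componentD IHu IHv linearD.
rewrite (component_homog _ (delbar_bideg vrs)) (component_homog _ vrs).
by rewrite !xpair_eqE subr_eq; case: ifP => //; rewrite linear0.
Qed.

Lemma component_dtot v p q : component (dtot v) (p, q) =
  del A (component v (p - 1, q)) + delbar A (component v (p, q - 1)).
Proof. by rewrite componentD component_del component_delbar. Qed.

Lemma component_proj S v pq :
  component (proj S v) pq = if pq \in S then component v pq else 0.
Proof.
pose x rs := if rs \in S then component v rs else 0.
rewrite componentE; apply: (coord_unique (bideg_direct_sum A) (x := x)) => [rs||].
- by rewrite /x; case: ifP => _; [exact: component_bideg|exact: bideg0].
- apply: sub_finite_set (coord_fin (bideg_direct_sum A) v) => rs /=.
  by rewrite /x -componentE; case: ifP => // _; rewrite eqxx.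
- by rewrite /proj fsbig_mkcond; apply: eq_fsbigr => rs _; rewrite /patch /x.
Qed.

Lemma proj_linear S : linear (@proj R A S).
Proof.
move=> a u v; apply: component_ext => pq.
rewrite componentD componentZ !component_proj componentD componentZ.
by case: ifP => // _; rewrite scaler0 addr0.
Qed.

Lemma projD S u v : proj S (u + v) = proj S u + proj S v.
Proof. by have := proj_linear S 1 u v; rewrite !scale1r. Qed.

Lemma bigolin_diff_linear p q k : linear (@bigolin_diff R A p q k).
Proof.
move=> a u v; rewrite /bigolin_diff /dtot; case: ifP => _.
  by rewrite -proj_linear !linearP scalerDr addrACA.
by case: ifP => _; rewrite !linearP // scalerDr addrACA.
Qed.

HB.instance Definition _ p q k :=
  GRing.isLinear.Build _ A A _ (@bigolin_diff R A p q k) (@bigolin_diff_linear p q k).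

Lemma bigolin_space_submod p q k a u v :
  bigolin_space p q k u -> bigolin_space p q k v -> bigolin_space p q k (a *: u + v).
Proof.
by move=> Hu Hv rs nrs; rewrite componentD componentZ Hu // Hv // scaler0 addr0.
Qed.

Lemma bigolin_space0 p q k : bigolin_space p q k (0 : A).
Proof. by move=> rs _; exact: component0. Qed.

Lemma bigolin_coboundaries_lin p q k a u v :
  bigolin_coboundaries p q k u -> bigolin_coboundaries p q k v ->
  bigolin_coboundaries p q k (a *: u + v).
Proof.
move=> [u' Hu <-] [v' Hv <-]; exists (a *: u' + v'); first exact: bigolin_space_submod.
by rewrite linearP.
Qed.

Lemma bigolin_coboundaries0 p q k : bigolin_coboundaries p q k (0 : A).
Proof. by exists 0; [exact: bigolin_space0|exact: linear0]. Qed.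

End A.

(** Expanding each basis in the other modulo [Y] gives matrices with [P *m Q = 1%:M], and the rank
    bound yields one inequality between the sizes; the other follows by symmetry. *)
Lemma quotient_dim_unique (V : lmodType R[i]) (Z Y : set V) m n :
  (forall a u v, Y u -> Y v -> Y (a *: u + v)) -> Y 0 ->
  quotient_dim Z Y m -> quotient_dim Z Y n -> m = n.
Proof.
move=> Ylin Y0.
have Ysum J (r : seq J) c (F : J -> V) : (forall j, Y (F j)) ->
    Y (\sum_(j <- r) c j *: F j).
  by move=> YF; elim/big_rec: _ => // j y _ Yy; exact: Ylin.
suff le m' n' : quotient_dim Z Y m' -> quotient_dim Z Y n' -> (m' <= n')%N.
  by move=> Hm Hn; apply/eqP; rewrite eqn_leq !le.
move=> [e [Ze He]] [g [Zg Hg]].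
have /choice[M HM] i := Hg _ (Ze i); have /choice[N HN] j := He _ (Zg j).
pose P := \matrix_(i, j) M i j; pose Q := \matrix_(j, i) N j i.
have PQ : P *m Q = 1%:M.
  apply/matrixP => i l; rewrite !mxE.
  (* A row of the product and a row of the identity are both coordinates of [e i] modulo [Y], hence
     equal to [c]. *)
  have [c [_ cU]] := He _ (Ze i).
  transitivity (c l).
    rewrite (cU (fun l => \sum_j P i j * Q j l)) //=.
    have /= := Ylin 1 _ _ (HM i).1 (Ysum _ (index_enum _) (M i) _ (fun j => (HN j).1)).
    congr Y; rewrite scale1r.
    under [X in _ + X]eq_bigr do rewrite scalerBr scaler_sumr.
    rewrite sumrB addrA subrK exchange_big /=; congr (_ - _).
    apply: eq_bigr => k _; rewrite scaler_suml; apply: eq_bigr => j _.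
    by rewrite scalerA !mxE.
  rewrite (cU (fun l => (i == l)%:R)) //=.
  rewrite (bigD1 i) //= eqxx scale1r big1 ?addr0 ?subrr //.
  by move=> k ki; rewrite eq_sym (negbTE ki) scale0r.
have := mulmx_max_rank P Q.
by rewrite PQ mxrank1.
Qed.

Lemma bigolin_number_eq A p q k n :
  quotient_dim (@bigolin_cocycles R A p q k) (@bigolin_coboundaries R A p q k) n ->
  bigolin_number A p q k = Some n.
Proof.
move=> H; rewrite /bigolin_number; case: pselect => [h|]; last by case; exists n.
case: cid => m /= Hm; congr Some; apply: quotient_dim_unique Hm H.
  exact: bigolin_coboundaries_lin.
exact: bigolin_coboundaries0.
Qed.

End Graded.

(** * Additivity of the Bigolin numbers *)

Section Decomposition.
Context {R : realType} {A : double_complex R} (D : decomposition A).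
Local Notation idx := (dec_index D).
Local Notation B := (fun i : idx => summand i).
Local Notation inj := (fun i : idx => summand_inj i).

Lemma decomposition_direct_sum :
  direct_sum (U := fun i => B i) inj (fun i => [set: B i]).
Proof.
split=> [i|v]; first by split=> [|a u v _ _]; rewrite in_setE.
have [x [[fx vx] xU]] := dec_direct D v; exists x; split=> //.
by move=> y [_ fy vy]; exact: xU.
Qed.

Definition pr i : {linear A -> summand i} := coord decomposition_direct_sum i.

Lemma pr_inj (i : idx) w : pr i (summand_inj i w) = w.
Proof. exact: (coord_f decomposition_direct_sum). Qed.

Lemma pr_inj0 (i j : idx) w : i <> j -> pr j (summand_inj i w) = 0.
Proof. exact: (coord_f0 decomposition_direct_sum). Qed.

Lemma pr_ext u v : (forall i, pr i u = pr i v) -> u = v.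
Proof. exact: (coord_ext (fW := decomposition_direct_sum)). Qed.

Lemma dec_ind (P : A -> Prop) : P 0 -> (forall u v, P u -> P v -> P (u + v)) ->
  (forall (i : idx) w, P (summand_inj i w)) -> forall v, P v.
Proof.
by move=> P0 PD Pi; apply: (coord_ind decomposition_direct_sum).
Qed.

Lemma component_inj (i : idx) w pq :
  component (summand_inj i w) pq = summand_inj i (component w pq).
Proof.
move: w; apply: homog_ind => [|u v IHu IHv|rs w wrs].
- by rewrite linear0 !component0 linear0.
- by rewrite linearD !componentD IHu IHv linearD.
rewrite (component_homog _ (summand_inj_bideg wrs)) (component_homog _ wrs).
by case: ifP; rewrite ?linear0.
Qed.

Lemma pr_del i v : pr i (del A v) = del (summand i) (pr i v).
Proof.
elim/dec_ind: v => [|u v IHu IHv|j w].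
- by rewrite !linear0.
- by rewrite !linearD IHu IHv.
rewrite -summand_inj_del; case: (pselect (j = i)) => [<-|ji].
  by rewrite !pr_inj.
by rewrite !pr_inj0 // linear0.
Qed.

Lemma pr_delbar i v : pr i (delbar A v) = delbar (summand i) (pr i v).
Proof.
elim/dec_ind: v => [|u v IHu IHv|j w].
- by rewrite !linear0.
- by rewrite !linearD IHu IHv.
rewrite -summand_inj_delbar; case: (pselect (j = i)) => [<-|ji].
  by rewrite !pr_inj.
by rewrite !pr_inj0 // linear0.
Qed.

Lemma pr_component i v pq : pr i (component v pq) = component (pr i v) pq.
Proof.
elim/dec_ind: v => [|u v IHu IHv|j w].
- by rewrite component0 !linear0 component0.
- by rewrite componentD !linearD IHu IHv componentD.
rewrite component_inj; case: (pselect (j = i)) => [<-|ji].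
  by rewrite !pr_inj.
by rewrite !pr_inj0 // component0.
Qed.

Lemma pr_bigolin_diff i p q k v :
  pr i (bigolin_diff p q k v) = bigolin_diff p q k (pr i v).
Proof.
rewrite /bigolin_diff; case: ifP => _.
  apply: component_ext => rs; rewrite -pr_component !component_proj.
  case: ifP => _; last exact: linear0.
  by rewrite pr_component /dtot linearD pr_del pr_delbar.
case: ifP => _; first by rewrite pr_del pr_delbar.
by rewrite /dtot linearD pr_del pr_delbar.
Qed.

Lemma pr_bigolin_space p q k v :
  bigolin_space p q k v <-> forall i, bigolin_space p q k (pr i v).
Proof.
split=> [vS i rs nrs|vS rs nrs]; first by rewrite -pr_component vS // linear0.
by apply: pr_ext => i; rewrite pr_component vS // linear0.
Qed.

Lemma pr_cocycles p q k v : bigolin_cocycles p q k v <->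
  forall i, bigolin_cocycles p q k (pr i v).
Proof.
split=> [[/pr_bigolin_space vS dv] i|vZ].
  by split=> //; rewrite -pr_bigolin_diff dv linear0.
split; first by apply/pr_bigolin_space => i; have [] := vZ i.
by apply: pr_ext => i; rewrite pr_bigolin_diff linear0; have [] := vZ i.
Qed.

(** For the converse, primitives of the components must assemble to a vector, so all but finitely
    many have to be zero: a vanishing component is given the primitive 0. *)
Lemma pr_coboundaries p q k v : bigolin_coboundaries p q k v <->
  forall i, bigolin_coboundaries p q k (pr i v).
Proof.
split=> [[u uS <-] i|vY].
  exists (pr i u); last by rewrite pr_bigolin_diff.
  exact: (pr_bigolin_space _ _ _ _).1 uS i.
have Hex : forall i, exists u, [/\ bigolin_space p q (k - 1) u,
    bigolin_diff p q (k - 1) u = pr i v & pr i v = 0 -> u = 0].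
  move=> i; case: (pselect (pr i v = 0)) => [->|vi].
    by exists 0; split=> //; [exact: bigolin_space0|exact: linear0].
  by have [u uS uv] := vY i; exists u.
pose u i := sval (cid (Hex i)); have Hu i := svalP (cid (Hex i)).
have [s us [s0 vs]] := coord_seq decomposition_direct_sum v.
pose w := \sum_(i <- s) summand_inj i (u i).
have prw i : pr i w = u i.
  apply: (coord_sum_seq decomposition_direct_sum) => // j js.
  by have [_ _ uj] := Hu j; apply: uj; exact: s0.
exists w; first by apply/pr_bigolin_space => i; rewrite prw; have [] := Hu i.
by apply: pr_ext => i; rewrite pr_bigolin_diff prw; have [] := Hu i.
Qed.

End Decomposition.

Section BigolinCount.
Context {R : realType}.

(** Uniqueness of [c] forces the class of [z] to be nonzero, so the cohomology is a line and not
    merely spanned by [z]. *)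
Definition bigolin_gen (B : double_complex R) p q k (z : B) : Prop :=
  bigolin_cocycles p q k z /\
  forall w, bigolin_cocycles p q k w ->
    exists! c : R[i], bigolin_coboundaries p q k (w - c *: z).

(* The Bigolin number is b, that is, 1 or 0. *)
Definition bigolin_01 (B : double_complex R) p q k (b : bool) : Prop :=
  if b then exists z : B, bigolin_gen p q k z
  else forall w : B, bigolin_cocycles p q k w -> bigolin_coboundaries p q k w.

Context {A : double_complex R} (D : decomposition A).

(** Summands outside [s] are acyclic in this degree, so even infinitely many of them leave the
    generators indexed by [s] a basis of the cohomology. *)
Lemma quotient_dim_sum p q k (s : seq (dec_index D)) (z : forall i, @summand _ _ D i) :
  uniq s -> (forall i, i \in s -> bigolin_gen p q k (z i)) ->
  (forall i, i \notin s -> bigolin_01 (@summand _ _ D i) p q k false) ->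
  quotient_dim (@bigolin_cocycles R A p q k) (@bigolin_coboundaries R A p q k) (size s).
Proof.
move=> us Hs Hns; pose S l := tnth (in_tuple s) l.
have Sin l : S l \in s by exact: mem_tnth.
have Sinj l l' : S l = S l' -> l = l' by move=> /(tuple_uniqP (in_tuple s) us).
have prz (c : 'I_(size s) -> R[i]) l :
    pr (S l) (\sum_j c j *: summand_inj (S j) (z (S j))) = c l *: z (S l).
  rewrite linear_sum (bigD1 l) //= linearZ /= pr_inj big1 ?addr0 // => j jl.
  rewrite linearZ /= pr_inj0 ?scaler0 // => /Sinj ejl.
  by rewrite ejl eqxx in jl.
have prz0 (c : 'I_(size s) -> R[i]) i : i \notin s ->
    pr i (\sum_j c j *: summand_inj (S j) (z (S j))) = 0.
  move=> si; rewrite linear_sum big1 // => j _.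
  rewrite linearZ /= pr_inj0 ?scaler0 // => Sj.
  by rewrite -Sj Sin in si.
exists (fun l => summand_inj (S l) (z (S l))); split=> [l|v vZ].
  apply/(pr_cocycles D) => i; case: (pselect (S l = i)) => [<-|li].
    by rewrite pr_inj; have [] := Hs _ (Sin l).
  rewrite pr_inj0 //; split; first exact: bigolin_space0.
  exact: linear0.
have viZ := (pr_cocycles D _ _ _ _).1 vZ.
have /choice[c Hc] l := (Hs _ (Sin l)).2 _ (viZ (S l)).
exists c; split=> [|c' /(pr_coboundaries D) Hc']; last first.
  apply/funext => l; have [_ cU] := Hc l; apply: cU.
  by have := Hc' (S l); rewrite linearB prz.
apply/(pr_coboundaries D) => i; rewrite linearB.
case: (boolP (i \in s)) => [/(tnthP (in_tuple s))[l ->]|si].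
  by rewrite prz; have [] := Hc l.
by rewrite prz0 // subr0; exact: (Hns i si).
Qed.

Lemma bigolin_number_count p q k (s : seq (dec_index D)) (b : pred (dec_index D)) :
  uniq s -> (forall i, i \notin s -> ~~ b i) ->
  (forall i, bigolin_01 (@summand _ _ D i) p q k (b i)) ->
  bigolin_number A p q k = Some (count b s).
Proof.
move=> us nb H; rewrite -size_filter.
have Hex i : exists z : @summand _ _ D i, b i -> bigolin_gen p q k z.
  by have := H i; case: (b i) => [[z]|_]; [exists z|exists 0].
apply/bigolin_number_eq/(quotient_dim_sum (z := fun i => sval (cid (Hex i)))).
- exact: filter_uniq.
- by move=> i; rewrite mem_filter => /andP[bi _]; exact: (svalP (cid (Hex i))).
- move=> i; rewrite mem_filter negb_and => bi.
  have /negbTE bi0 : ~~ b i by case/orP: bi => // /nb.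
  by have := H i; rewrite bi0.
Qed.

End BigolinCount.

(** * Squares *)

Section BigolinCalculus.
Context {R : realType}.

Lemma bigolin_regionE (p q k r s : int) : bigolin_region p q k (r, s) <->
  (k <= p + q /\ r + s = k /\ r <= p /\ s <= q) \/
  (p + q < k /\ r + s = k + 1 /\ p < r /\ q < s).
Proof.
rewrite /bigolin_region; case: ifP => kpq /=.
  by split=> [[*]|H]; [left|split; lia].
by split=> [[*]|H]; [right; lia|split; lia].
Qed.

Context {B : double_complex R}.
Implicit Types u v w : B.

Lemma proj_homog S pq v : bideg B pq v -> proj S v = if pq \in S then v else 0.
Proof.
move=> vpq; apply: component_ext => rs.
rewrite component_proj (component_homog _ vpq).
case: (eqVneq rs pq) => [->|rspq].
  by case: ifP => _; rewrite ?component0 // (component_homog _ vpq) eqxx.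
rewrite if_same; case: ifP => _; last by rewrite component0.
by rewrite (component_homog _ vpq) (negbTE rspq).
Qed.

Lemma in_box (p q r s : int) :
  ((r, s) \in bigolin_box p q) = (r <= p) && (s <= q).
Proof. by apply/idP/andP; rewrite inE. Qed.

Lemma homog_space p q k pq v :
  bideg B pq v -> (v != 0 -> bigolin_region p q k pq) -> bigolin_space p q k v.
Proof.
move=> vpq H rs nrs; rewrite (component_homog _ vpq); case: eqP => // e.
by apply/eqP; apply: contrapT => /negP /H; rewrite -e.
Qed.

Lemma single_component w pq :
  (forall rs, rs != pq -> component w rs = 0) -> w = component w pq.
Proof.
move=> H; apply: component_ext => rs.
rewrite (component_homog _ (component_bideg w pq)).
by case: eqVneq => [->|/H].
Qed.

Lemma two_components w pq pq' : pq != pq' ->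
  (forall rs, rs != pq -> rs != pq' -> component w rs = 0) ->
  w = component w pq + component w pq'.
Proof.
move=> pp' H; apply: component_ext => rs.
rewrite componentD !(component_homog _ (component_bideg w _)).
case: (eqVneq rs pq) => [->|n1]; first by rewrite (negbTE pp') addr0.
by case: (eqVneq rs pq') => [->|n2]; rewrite ?add0r // H.
Qed.

Lemma thin0 S pq v : thin S B -> ~ S pq -> bideg B pq v -> v = 0.
Proof. by move=> [_ H _ _] /H ->. Qed.

Lemma thin_component S pq v : thin S B -> ~ S pq -> component v pq = 0.
Proof. by move=> tB Spq; apply: (thin0 tB Spq); exact: component_bideg. Qed.

Lemma thin_del_inj S p q v : thin S B -> S (p, q) -> S (p + 1, q) ->
  bideg B (p, q) v -> del B v = 0 -> v = 0.
Proof.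
move=> [_ _ H _] S1 S2 vpq dv; have [_ inj _] := H _ _ S1 S2.
by apply: inj; rewrite ?inE //; [exact: bideg0|rewrite linear0].
Qed.

Lemma thin_delbar_inj S p q v : thin S B -> S (p, q) -> S (p, q + 1) ->
  bideg B (p, q) v -> delbar B v = 0 -> v = 0.
Proof.
move=> [_ _ _ H] S1 S2 vpq dv; have [_ inj _] := H _ _ S1 S2.
by apply: inj; rewrite ?inE //; [exact: bideg0|rewrite linear0].
Qed.

Lemma thin_del_surj S p q w : thin S B -> S (p, q) -> S (p + 1, q) ->
  bideg B (p + 1, q) w -> exists2 v, bideg B (p, q) v & del B v = w.
Proof. by move=> [_ _ H _] S1 S2; have [_ _ sur] := H _ _ S1 S2; exact: sur. Qed.

Lemma thin_delbar_surj S p q w : thin S B -> S (p, q) -> S (p, q + 1) ->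
  bideg B (p, q + 1) w -> exists2 v, bideg B (p, q) v & delbar B v = w.
Proof. by move=> [_ _ _ H] S1 S2; have [_ _ sur] := H _ _ S1 S2; exact: sur. Qed.

End BigolinCalculus.

Section Square.
Context {R : realType} {B : double_complex R} {a b : int}.
Let S : set (int * int) := [set (a, b); (a + 1, b); (a, b + 1); (a + 1, b + 1)].
Hypothesis tB : thin S B.
Implicit Types u v w : B.

Let SP r s : S (r, s) <-> (a <= r <= a + 1) && (b <= s <= b + 1).
Proof.
split; first by move=> [[[]|]|] [-> ->]; lia.
move=> H; have [er|er] : r = a \/ r = a + 1 by lia.
  have [es|es] : s = b \/ s = b + 1 by lia.
    by left; left; left; rewrite er es.
  by left; right; rewrite er es.
have [es|es] : s = b \/ s = b + 1 by lia.
  by left; left; right; rewrite er es.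
by right; rewrite er es.
Qed.

(** A cocycle lives in the single total degree [deg]. At the lowest corner it is killed by
    injectivity of an arrow or of [del delbar]. Above it, the cocycle either has a primitive
    obtained by inverting an arrow, or vanishes; which one depends on the corners that survive the
    truncation. *)
Lemma square_acyclic p q k : bigolin_01 B p q k false.
Proof.
move=> w [wS dw].
have w0 (r s : int) : ~ S (r, s) -> component w (r, s) = 0 by exact: thin_component.
have wR (r s : int) : ~ bigolin_region p q k (r, s) -> component w (r, s) = 0.
  exact: wS.
have vanish : w = 0 -> bigolin_coboundaries p q k w.
  by move=> ->; exact: bigolin_coboundaries0.
have Sab : S (a, b) by apply/SP; lia.
have Sa1b : S (a + 1, b) by apply/SP; lia.
have Sab1 : S (a, b + 1) by apply/SP; lia.
have Sa1b1 : S (a + 1, b + 1) by apply/SP; lia.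
pose deg := if k <= p + q then k else k + 1.
have degP : (k <= p + q /\ deg = k) \/ (p + q < k /\ deg = k + 1).
  by rewrite /deg; case: ifP => ?; [left|right]; lia.
clearbody deg.
have wdeg (r s : int) : r + s <> deg -> component w (r, s) = 0.
  by move=> H; apply: wR => /bigolin_regionE; lia.
case: (pselect (deg = a + b)) => [dx|ndx].
  have wx : w = component w (a, b).
    apply: single_component => -[r s]; rewrite xpair_eqE => rs.
    case: (pselect (S (r, s))) => [/SP rsS|/w0 //]; apply: wdeg; lia.
  have wab : bideg B (a, b) w by rewrite wx; exact: component_bideg.
  apply: vanish; apply: contrapT => wn0.
  have : bigolin_region p q k (a, b).
    by apply: contrapT => /wR; rewrite -wx.
  move/bigolin_regionE => rab.
  case: (pselect (k = p + q)) => [kpq|kpq].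
    apply: wn0; apply: (thin_delbar_inj tB Sab Sab1 wab).
    apply: (thin_del_inj tB Sab1 Sa1b1 (delbar_bideg wab)).
    by move: dw; rewrite /bigolin_diff ifF; [rewrite ifT //; apply/eqP|lia].
  have dw1 (r s : int) : (r, s) \in bigolin_box p q \/ p + q < k ->
      component (dtot w) (r, s) = 0.
    move=> H; move: dw => /(congr1 (fun v => component v (r, s))).
    rewrite /bigolin_diff component0; case: ifP => kpq'.
      rewrite component_proj ifT //; case: H => //; lia.
    by rewrite ifF //; apply/eqP.
  (* For [k < p + q] a neighbour of [(a, b)] stays in the box, since [a = p] and [b = q] would give
     [k = p + q]. *)
  have [H|H] : ((a + 1, b) \in bigolin_box p q \/ p + q < k) \/
         ((a, b + 1) \in bigolin_box p q \/ p + q < k).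
    rewrite !in_box; lia.
  - apply: wn0; apply: (thin_del_inj tB Sab Sa1b wab).
    move: (dw1 _ _ H); rewrite component_dtot addrK -wx.
    rewrite (w0 (a + 1)) ?linear0 ?addr0 // => /SP; lia.
  - apply: wn0; apply: (thin_delbar_inj tB Sab Sab1 wab).
    move: (dw1 _ _ H); rewrite component_dtot addrK -wx.
    rewrite (w0 _ (b + 1)) ?linear0 ?add0r // => /SP; lia.
case: (pselect (deg = a + b + 1)) => [dyz|ndyz].
  have wyz : w = component w (a + 1, b) + component w (a, b + 1).
    apply: two_components => [|[r s]]; rewrite !xpair_eqE; first lia.
    move=> rs rs'; case: (pselect (S (r, s))) => [/SP rsS|/w0 //].
    apply: wdeg; lia.
  set y := component w (a + 1, b) in wyz; set z := component w (a, b + 1) in wyz.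
  have yB : bideg B (a + 1, b) y by exact: component_bideg.
  have zB : bideg B (a, b + 1) z by exact: component_bideg.
  have [x1 x1B dx1] := thin_del_surj tB Sab Sa1b yB.
  have [x2 x2B dx2] := thin_delbar_surj tB Sab Sab1 zB.
  (* The primitive of [y] along [del] is then also one of [z] along [delbar], by anticommutation and
     injectivity of [del] into the top corner. *)
  have glue : del B z + delbar B y = 0 -> delbar B x1 = z.
    move=> H; apply/eqP; rewrite -subr_eq0; apply/eqP.
    apply: (thin_del_inj tB Sab1 Sa1b1).
      rewrite -[_ - _]addrC -scaleN1r; apply: bidegP => //; exact: delbar_bideg.
    rewrite linearB; move: (del_delbar x1); rewrite dx1 => /eqP.
    rewrite addr_eq0 => /eqP ->; apply/eqP; rewrite -opprD oppr_eq0 addrC.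
    exact/eqP.
  have y0 : ~ bigolin_region p q k (a + 1, b) -> y = 0 by exact: wR.
  have z0 : ~ bigolin_region p q k (a, b + 1) -> z = 0 by exact: wR.
  have zy : (a + 1, b + 1) \in bigolin_box p q \/ p + q < k ->
      del B z + delbar B y = 0.
    move=> H; move: dw => /(congr1 (fun v => component v (a + 1, b + 1))).
    rewrite /bigolin_diff component0; case: ifP => kpq.
      by rewrite component_proj ifT ?component_dtot ?addrK //; case: H => //; lia.
    rewrite ifF ?component_dtot ?addrK //; apply/eqP; case: H; rewrite ?in_box; lia.
  case: degP => -[kpq degE].
    have kpq1 : k - 1 < p + q by lia.
    case: (pselect (bigolin_region p q k (a + 1, b))) => [ry|ny].
      exists x1.
        apply: (homog_space x1B) => _; apply/bigolin_regionE.
        by move/bigolin_regionE: ry => ry; lia.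
      rewrite /bigolin_diff kpq1 /dtot projD dx1 (proj_homog _ yB).
      rewrite (proj_homog _ (delbar_bideg x1B)) !in_box.
      move/bigolin_regionE: ry => ry; rewrite ifT; last by lia.
      case: ifP => H; first by rewrite glue // zy // in_box; left; lia.
      by rewrite wyz z0 // => /bigolin_regionE; lia.
    case: (pselect (bigolin_region p q k (a, b + 1))) => [rz|nz].
      exists x2.
        apply: (homog_space x2B) => _; apply/bigolin_regionE.
        by move/bigolin_regionE: rz => rz; lia.
      rewrite /bigolin_diff kpq1 /dtot projD dx2 (proj_homog _ zB).
      rewrite (proj_homog _ (del_bideg x2B)) !in_box.
      move/bigolin_regionE: rz => rz; rewrite [X in _ + X]ifT; last by lia.
      rewrite wyz y0 // ifF //; apply: contra_notF ny => H.
      by apply/bigolin_regionE; lia.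
    by apply: vanish; rewrite wyz y0 // z0 // addr0.
  have {}zy : del B z + delbar B y = 0 by apply: zy; right.
  (* Past [del delbar], the corner [(a, b)] is available exactly when both middle corners are. If
     only one of them is, the cocycle condition and injectivity give [w = 0]. *)
  case: (pselect (bigolin_region p q k (a + 1, b))) => [/bigolin_regionE ry|ny].
    case: (pselect (bigolin_region p q k (a, b + 1))) => [/bigolin_regionE rz|nz].
      exists x1.
        apply: (homog_space x1B) => _; apply/bigolin_regionE.
        by lia.
      rewrite /bigolin_diff ifF; last by lia.
      by rewrite ifF /dtot ?dx1 ?glue //; lia.
    apply: vanish; move: zy; rewrite wyz z0 // linear0 add0r => dy.
    by rewrite (thin_delbar_inj tB Sa1b Sa1b1 yB dy) addr0.
  apply: vanish; move: zy; rewrite wyz y0 // linear0 addr0 => dz.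
  by rewrite (thin_del_inj tB Sab1 Sa1b1 zB dz) addr0.
have wx : w = component w (a + 1, b + 1).
  apply: single_component => -[r s]; rewrite xpair_eqE => rs.
  case: (pselect (S (r, s))) => [/SP rsS|/w0 //]; apply: wdeg; lia.
have wB : bideg B (a + 1, b + 1) w by rewrite wx; exact: component_bideg.
case: (pselect (bigolin_region p q k (a + 1, b + 1))) => [/bigolin_regionE rw|/wR H].
  have [z zB dz] := thin_del_surj tB Sab1 Sa1b1 wB.
  have [y yB dy] := thin_delbar_surj tB Sa1b Sa1b1 wB.
  have [x xB dx] := thin_delbar_surj tB Sab Sab1 zB.
  have dz0 : delbar B z = 0.
    by apply: (thin0 tB _ (delbar_bideg zB)) => /SP; lia.
  have dy0 : del B y = 0 by apply: (thin0 tB _ (del_bideg yB)) => /SP; lia.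
  case: degP => -[kpq degE].
    exists z.
      apply: (homog_space zB) => _; apply/bigolin_regionE.
      by lia.
    rewrite /bigolin_diff ifT; last by lia.
    by rewrite /dtot dz dz0 addr0 (proj_homog _ wB) in_box ifT //; lia.
  (* If [k - 1 = p + q] then [(a, b) = (p, q)], and [w] is reached by [del delbar]. Otherwise
     [p < a] or [q < b], which puts a middle corner into the preceding term. *)
  case: (pselect (k - 1 = p + q)) => [k1|k1].
    exists x.
      apply: (homog_space xB) => _; apply/bigolin_regionE.
      by lia.
    rewrite /bigolin_diff ifF; last by lia.
    by rewrite ifT ?dx //; lia.
  have [H|H] : p < a \/ q < b by lia.
    exists z.
      apply: (homog_space zB) => _; apply/bigolin_regionE.
      by lia.
    rewrite /bigolin_diff ifF; last by lia.
    by rewrite ifF /dtot ?dz ?dz0 ?addr0 //; lia.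
  exists y.
    apply: (homog_space yB) => _; apply/bigolin_regionE.
    by lia.
  rewrite /bigolin_diff ifF; last by lia.
  by rewrite ifF /dtot ?dy ?dy0 ?add0r //; lia.
by apply: vanish; rewrite wx.
Qed.

End Square.

Arguments square_acyclic {R B a b} tB p q k.

(** * Zigzags *)

Section DimensionOne.
Context {R : realType} {V : lmodType R[i]}.

Lemma quotient_dim0_1 (Z : set V) : quotient_dim Z [set 0] 1 ->
  exists e, [/\ Z e, e != 0 & forall z, Z z -> exists c : R[i], z = c *: e].
Proof.
move=> [e [Ze He]]; exists (e ord0); split=> // [|z /He[c [/eqP]]].
  apply/eqP => e0; have [c [_ cU]] := He _ (Ze ord0).
  have H x : [set 0] (e ord0 - \sum_(i < 1) (fun=> x) i *: e i).
    by rewrite /= big_ord1 e0 scaler0 subr0.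
  have := congr1 (@^~ ord0) (etrans (esym (cU _ (H 0))) (cU _ (H 1))) => /= /eqP.
  by rewrite eq_sym oner_eq0.
by rewrite big_ord1 subr_eq0 => /eqP ->; exists (c ord0).
Qed.

Lemma quotient_dim0_span (Z : set V) x z : quotient_dim Z [set 0] 1 ->
  Z x -> x != 0 -> Z z -> exists c : R[i], z = c *: x.
Proof.
move=> /quotient_dim0_1[e [_ e0 He]] /He[c ->] cn0 /He[c' ->].
have {cn0} c0 : c != 0 by apply: contraNneq cn0 => ->; rewrite scale0r.
by exists (c' / c); rewrite scalerA divfK.
Qed.

End DimensionOne.

Definition zigzag_set (d a : int) (m : nat) : set (int * int) :=
  [set path_vertex d (a + i%:Z) | i in `I_m].

Lemma path_vertex_even d c : path_vertex d (2 * c) = (c, d - c).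
Proof. by rewrite /path_vertex; congr (_, _); lia. Qed.

Lemma path_vertex_odd d c : path_vertex d (2 * c + 1) = (c + 1, d - c).
Proof. by rewrite /path_vertex; congr (_, _); lia. Qed.

Lemma path_vertex_pred d c : path_vertex d (2 * c - 1) = (c, d - c + 1).
Proof. by rewrite /path_vertex; congr (_, _); lia. Qed.

Lemma path_vertex_inj d i j : path_vertex d i = path_vertex d j -> i = j.
Proof. by rewrite /path_vertex => -[]; lia. Qed.

Lemma zigzag_setP d a m rs : zigzag_set d a m rs <->
  exists2 i, a <= i < a + m%:Z & rs = path_vertex d i.
Proof.
split=> [[i /= im <-]|[i im ->]]; first by exists (a + i%:Z) => //; lia.
exists `|i - a|%N => /=; first lia.
by congr path_vertex; lia.
Qed.

Lemma zigzag_set_vertex d a m i :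
  zigzag_set d a m (path_vertex d i) <-> a <= i < a + m%:Z.
Proof.
split=> [/zigzag_setP[j jm /path_vertex_inj->]|im] //.
by apply/zigzag_setP; exists i.
Qed.

Lemma zigzag_setE d a m r s : zigzag_set d a m (r, s) <->
  (r + s = d /\ a <= 2 * r < a + m%:Z) \/
  (r + s = d + 1 /\ a <= 2 * r - 1 < a + m%:Z).
Proof.
split=> [/zigzag_setP[i im]|]; first by rewrite /path_vertex => -[]; lia.
move=> [[rs im]|[rs im]]; apply/zigzag_setP.
  by exists (2 * r) => //; rewrite path_vertex_even; congr (_, _); lia.
by exists (2 * r - 1) => //; rewrite path_vertex_pred; congr (_, _); lia.
Qed.

Section ZigzagBasis.
Context {R : realType} {B : double_complex R} {d a : int} {m : nat}.
Hypothesis tB : thin (zigzag_set d a m) B.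
Local Notation rng i := (a <= i < a + m%:Z).

(* The generators are normalised along the path so that the boundary of
   sum c_i X_i has coefficient c_(i-1) - c_(i+1) at every odd vertex i. *)
Lemma zigzag_basis : (0 < m)%N -> exists X : int -> B,
  [/\ forall i, bideg B (path_vertex d i) (X i),
      forall i : int, (X i != 0) = rng i,
      forall c : int, rng (2 * c) -> del B (X (2 * c)) = X (2 * c + 1) &
      forall c : int, rng (2 * c) -> delbar B (X (2 * c)) = - X (2 * c - 1)].
Proof.
move=> m0.
have [dimS S0 _ _] := tB.
have [e [eB en0 _]] : exists e, [/\ bideg B (path_vertex d a) e, e != 0 &
    forall z, bideg B (path_vertex d a) z -> exists c : R[i], z = c *: e].
  by apply/quotient_dim0_1/dimS/zigzag_set_vertex; lia.
(* From an even vertex one follows [del]; from an odd vertex one needs a preimage under [delbar].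
   The default 0 of [xget] is excluded in [step] by surjectivity. *)
pose next (l : nat) (x : B) : B := if ((a + l%:Z) %% 2)%Z == 0 then del B x else
  xget 0 [set y | bideg B (path_vertex d (a + l.+1%:Z)) y /\ delbar B y = - x].
pose x := fix x l := if l is l'.+1 then next l' (x l') else e.
have in_set (i : int) : rng i -> zigzag_set d a m (path_vertex d i).
  by move=> ?; apply/zigzag_set_vertex.
have step l : (l.+1 < m)%N -> bideg B (path_vertex d (a + l%:Z)) (x l) ->
    x l != 0 ->
  [/\ bideg B (path_vertex d (a + l.+1%:Z)) (x l.+1), x l.+1 != 0 &
    if ((a + l%:Z) %% 2)%Z == 0 then x l.+1 = del B (x l)
    else delbar B (x l.+1) = - x l].
  move=> lm xB xn0 /=.
  have Sl : zigzag_set d a m (path_vertex d (a + l%:Z)) by apply: in_set; lia.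
  have Sl1 : zigzag_set d a m (path_vertex d (a + l.+1%:Z)) by apply: in_set; lia.
  rewrite /next; case: ifP => par.
    have [c ec] : exists c, a + l%:Z = 2 * c by exists ((a + l%:Z) %/ 2)%Z; lia.
    move: xB Sl Sl1; have -> : a + l.+1%:Z = 2 * c + 1 by lia.
    rewrite ec path_vertex_even path_vertex_odd => xB Sl Sl1.
    split=> //; first exact: del_bideg.
    by apply: contraNneq xn0 => /(thin_del_inj tB Sl Sl1 xB) ->.
  have [c ec] : exists c, a + l.+1%:Z = 2 * c by exists ((a + l.+1%:Z) %/ 2)%Z; lia.
  move: xB Sl Sl1; have -> : a + l%:Z = 2 * c - 1 by lia.
  rewrite ec path_vertex_even path_vertex_pred => xB Sl Sl1.
  case: xgetP => [y _ [yB yx]|H]; last first.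
    have [y yB yx] := thin_delbar_surj tB Sl1 Sl (bidegN xB).
    by case: (H y).
  split=> //; apply: contraNneq xn0 => y0; move: yx.
  by rewrite y0 linear0 => /eqP; rewrite eq_sym oppr_eq0.
have xP l : (l < m)%N -> bideg B (path_vertex d (a + l%:Z)) (x l) /\ x l != 0.
  elim: l => [|l IHl] lm; first by rewrite addr0.
  by have [] := step l lm (IHl (ltnW lm)).1 (IHl (ltnW lm)).2.
pose X (i : int) := if rng i then x `|i - a|%N else 0.
have XB i : bideg B (path_vertex d i) (X i).
  rewrite /X; case: ifP => im; last exact: bideg0.
  have -> : i = a + `|i - a|%N%:Z by lia.
  by rewrite addrAC subrr add0r; apply: (xP _ _).1; lia.
have Xn0 (i : int) : (X i != 0) = rng i.
  rewrite /X; case: ifP => im; last by rewrite eqxx.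
  by apply: (xP _ _).2; lia.
exists X; split=> // c cm.
  case: (boolP (rng (2 * c + 1))) => cm1.
    rewrite /X cm cm1; have -> : `|(2 * c + 1)%R - a|%N = `|(2 * c)%R - a|%N.+1 by lia.
    have lm : (`|(2 * c)%R - a|%N.+1 < m)%N by lia.
    have [_ _] := step _ lm (xP _ (ltnW lm)).1 (xP _ (ltnW lm)).2.
    by rewrite ifT //; lia.
  have /eqP -> : X (2 * c + 1) == 0 by rewrite -[_ == _]negbK Xn0.
  apply: (thin0 tB (pq := path_vertex d (2 * c + 1))).
    by move=> /zigzag_set_vertex; apply/negP.
  by rewrite path_vertex_odd; apply: del_bideg; rewrite -path_vertex_even.
case: (boolP (rng (2 * c - 1))) => cm1.
  rewrite /X cm cm1; have -> : `|(2 * c)%R - a|%N = `|(2 * c - 1)%R - a|%N.+1 by lia.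
  have lm : (`|(2 * c - 1)%R - a|%N.+1 < m)%N by lia.
  have [_ _] := step _ lm (xP _ (ltnW lm)).1 (xP _ (ltnW lm)).2.
  by rewrite ifF //; apply/negP; lia.
have /eqP -> : X (2 * c - 1) == 0 by rewrite -[_ == _]negbK Xn0.
rewrite oppr0; apply: (thin0 tB (pq := path_vertex d (2 * c - 1))).
  by move=> /zigzag_set_vertex; apply/negP.
by rewrite path_vertex_pred; apply: delbar_bideg; rewrite -path_vertex_even.
Qed.

End ZigzagBasis.

(** Partial sums from [e0] in both directions. The base point is left free because it decides where
    the primitive vanishes. *)
Lemma antidifference (V : zmodType) (h : int -> V) (e0 : int) :
  exists G : int -> V, G e0 = 0 /\ forall e, G (e + 1) = G e - h e.
Proof.
exists (fun e => if e0 <= e then - \sum_(l < `|e - e0|%N) h (e0 + l%:Z)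
             else \sum_(l < `|e0 - e|%N) h (e0 - 1 - l%:Z)).
split=> [|e]; first by rewrite lexx subrr big_ord0 oppr0.
case: (boolP (e0 <= e)) => ee.
  rewrite ifT; last by lia.
  have -> : `|(e + 1)%R - e0|%N = `|e - e0|%N.+1 by lia.
  by rewrite big_ord_recr /= opprD; congr (_ - h _); lia.
have -> : `|e0 - e|%N = `|e0 - (e + 1)%R|%N.+1 by lia.
rewrite big_ord_recr /=.
have -> : e0 - 1 - `|e0 - (e + 1)%R|%N%:Z = e by lia.
rewrite addrK; case: ifP => // e1.
have -> : `|(e + 1)%R - e0|%N = 0%N by lia.
have -> : `|e0 - (e + 1)%R|%N = 0%N by lia.
by rewrite !big_ord0 oppr0.
Qed.

Lemma constant_steps (T : Type) (f : int -> T) (e e' : int) : e <= e' ->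
  (forall j, e <= j < e' -> f (2 * j) = f (2 * j + 2)) -> f (2 * e) = f (2 * e').
Proof.
move=> ee; have {ee}[n ->] : exists n : nat, e' = e + n%:Z.
  by exists `|e' - e|%N; lia.
elim: n => [|n IHn] H; first by rewrite addr0.
rewrite IHn => [|j ej]; last by apply: H; lia.
by rewrite H; [congr f; lia|lia].
Qed.

Section ZigzagCoords.
Context {R : realType} {B : double_complex R} {d a : int} {m : nat}.
Hypothesis tB : thin (zigzag_set d a m) B.
Local Notation rng i := (a <= (i : int) < a + m%:Z).
Variable X : int -> B.
Hypothesis XB : forall i, bideg B (path_vertex d i) (X i).
Hypothesis Xn0 : forall i : int, (X i != 0) = rng i.
Hypothesis delX : forall c : int, rng (2 * c) -> del B (X (2 * c)) = X (2 * c + 1).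
Hypothesis delbarX : forall c : int, rng (2 * c) ->
  delbar B (X (2 * c)) = - X (2 * c - 1).
Implicit Types (u v w : B) (f g : int -> R[i]).

(** Since [X i = 0] off the range, the second clause is what makes the coefficients unique; it also
    spares a special formula for the differential at the ends. *)
Definition coords v f : Prop :=
  (forall i, component v (path_vertex d i) = f i *: X i) /\
  forall i : int, ~~ rng i -> f i = 0.

Lemma coords_ex v : exists f, coords v f.
Proof.
have /choice[f Hf] : forall i : int, exists c : R[i],
    component v (path_vertex d i) = c *: X i /\ (~~ rng i -> c = 0).
  move=> i; case: (boolP (rng i)) => im.
    have [dimS _ _ _] := tB.
    have XBi : quotient_dim (bideg B (path_vertex d i)) [set 0] 1.
      by apply: dimS; apply/zigzag_set_vertex.
    have Xi0 : X i != 0 by rewrite Xn0.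
    have [c ->] := quotient_dim0_span XBi (XB i) Xi0 (component_bideg v _).
    by exists c.
  exists 0; split=> //; rewrite scale0r; apply: (thin_component _ tB).
  by move=> /zigzag_set_vertex; apply/negP.
by exists f; split=> i; have [] := Hf i.
Qed.

Lemma component_off v r s : ~ (exists i, rng i /\ (r, s) = path_vertex d i) ->
  component v (r, s) = 0.
Proof.
move=> H; apply: (thin_component _ tB) => /zigzag_setP[i im e].
by apply: H; exists i.
Qed.

Lemma coords_ext u v f : coords u f -> coords v f -> u = v.
Proof.
move=> [uf _] [vf _]; apply: component_ext => -[r s].
case: (pselect (exists i, rng i /\ (r, s) = path_vertex d i)) => [[i [_ ->]]|H].
  by rewrite uf vf.
by rewrite !component_off.
Qed.

Lemma coords_uniq v f g : coords v f -> coords v g -> f =1 g.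
Proof.
move=> [vf f0] [vg g0] i; case: (boolP (rng i)) => im; last by rewrite f0 ?g0.
apply/eqP; rewrite -subr_eq0.
have /eqP : (f i - g i) *: X i = 0 by rewrite scalerBl -vf -vg subrr.
by rewrite scaler_eq0 (negbTE (_ : X i != 0)) ?orbF // Xn0.
Qed.

Lemma coords_eq v f g : coords v f -> f =1 g -> coords v g.
Proof. by move=> vf /funext <-. Qed.

Lemma coords0 : coords 0 (fun=> 0).
Proof. by split=> // i; rewrite component0 scale0r. Qed.

Lemma coordsZD x u v f g : coords u f -> coords v g ->
  coords (x *: u + v) (fun i => x * f i + g i).
Proof.
move=> [uf f0] [vg g0]; split=> i; last by move=> im; rewrite f0 ?g0 ?mulr0 ?addr0.
by rewrite componentD componentZ uf vg scalerDl scalerA.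
Qed.

Lemma coords_build f : (forall i : int, ~~ rng i -> f i = 0) -> exists v, coords v f.
Proof.
move=> f0; exists (\sum_(l < m) f (a + l%:Z) *: X (a + l%:Z)).
split=> // i; rewrite component_sum.
have E l : component (f (a + l%:Z) *: X (a + l%:Z)) (path_vertex d i) =
    if a + l%:Z == i then f i *: X i else 0.
  rewrite componentZ (component_homog _ (XB _)).
  case: (eqVneq (a + l%:Z) i) => [->|li]; first by rewrite eqxx.
  case: eqP => [/path_vertex_inj/esym/eqP|]; rewrite ?scaler0 //.
  by rewrite (negbTE li).
under eq_bigr do rewrite E.
case: (boolP (rng i)) => im; last first.
  by rewrite f0 // scale0r big1 // => l _; rewrite if_same.
have lm : (`|i - a|%N < m)%N by lia.
rewrite (bigD1 (Ordinal lm)) //= ifT; last by apply/eqP; lia.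
rewrite big1 ?addr0 // => l ll; case: ifP => // /eqP il.
by case/eqP: ll; apply: val_inj => /=; lia.
Qed.

Lemma coords_space p q k v f : coords v f ->
  bigolin_space p q k v <->
  forall i, ~ bigolin_region p q k (path_vertex d i) -> f i = 0.
Proof.
move=> [vf f0]; split=> [vS i nr|H [r s] nr].
  case: (boolP (rng i)) => im; last by rewrite f0.
  move: (vS _ nr); rewrite vf => /eqP.
  by rewrite scaler_eq0 (negbTE (_ : X i != 0)) ?orbF ?Xn0 // => /eqP.
case: (pselect (exists i, rng i /\ (r, s) = path_vertex d i))
  => [[i [_ e]]|/component_off //].
by rewrite e vf H ?scale0r // -e.
Qed.

Lemma coords_proj S v f : coords v f ->
  coords (proj S v) (fun i => if path_vertex d i \in S then f i else 0).
Proof.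
move=> [vf f0]; split=> i; last by move=> /f0 ->; rewrite if_same.
by rewrite component_proj vf; case: ifP => // _; rewrite scale0r.
Qed.

Lemma coords_dtot v f : coords v f -> coords (dtot v)
  (fun i => if rng i && ((i %% 2)%Z == 1) then f (i - 1) - f (i + 1) else 0).
Proof.
move=> [vf f0]; split=> i; last by case: ifP => // /andP[->].
case: (boolP (rng i)) => im /=; last first.
  rewrite scale0r; apply: (thin_component _ tB).
  by move=> /zigzag_set_vertex; apply/negP.
case: ifP => par.
  have [c ec] : exists c, i = 2 * c + 1 by exists ((i - 1) %/ 2)%Z; lia.
  rewrite ec path_vertex_odd component_dtot addrK.
  rewrite -path_vertex_even; have -> : (c + 1, d - c - 1) = path_vertex d (2 * (c + 1)).
    by rewrite path_vertex_even; congr (_, _); lia.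
  rewrite addrK !vf !linearZ /= scalerBl.
  have -> : 2 * c + 1 + 1 = 2 * (c + 1) by lia.
  congr (_ + _).
    case: (boolP (rng (2 * c))) => cm; first by rewrite delX.
    by rewrite f0 // !scale0r.
  case: (boolP (rng (2 * (c + 1)))) => cm; last by rewrite f0 // !scale0r oppr0.
  by rewrite delbarX // scalerN; congr (- (_ *: X _)); lia.
have [c ec] : exists c, i = 2 * c by exists (i %/ 2)%Z; lia.
rewrite ec path_vertex_even component_dtot scale0r.
by rewrite !(thin_component _ tB) ?linear0 ?addr0 // => /zigzag_setE; lia.
Qed.

(** The composite raises the total degree by 2, while a zigzag occupies two consecutive degrees. *)
Lemma zigzag_del_delbar v : del B (delbar B v) = 0.
Proof.
apply: component_ext => -[r s]; rewrite component0 component_del component_delbar.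
case: (pselect (zigzag_set d a m (r, s))) => [/zigzag_setE rs|rs].
  by rewrite (thin_component _ tB) ?linear0 // => /zigzag_setE; lia.
apply: (thin0 tB rs).
by have := del_bideg (delbar_bideg (component_bideg v (r - 1, s - 1))); rewrite !subrK.
Qed.

(* The indices i for which [path_vertex d i] lies in the quadrant that supports
   the part of the Bigolin complex containing degree k. *)
Definition bigolin_window p q k (i : int) : bool :=
  if k <= p + q then 2 * (d - q) <= i <= 2 * p
  else 2 * p + 1 <= i <= 2 * (d - q) - 1.

(* The total degree in A of the k-th term of the Bigolin complex. *)
Definition bigolin_degree (p q k : int) : int := if k <= p + q then k else k + 1.

Lemma region_vertex p q k i : bigolin_region p q k (path_vertex d i) <->
  bigolin_window p q k i /\ d + (i %% 2)%Z = bigolin_degree p q k.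
Proof.
rewrite /bigolin_window /bigolin_degree /path_vertex bigolin_regionE.
by case: ifP => kpq; lia.
Qed.

Lemma coords_diff p q k v f : coords v f -> bigolin_space p q k v ->
  coords (bigolin_diff p q k v)
    (fun i => if [&& rng i, bigolin_window p q k i & (i %% 2)%Z == 1]
              then f (i - 1) - f (i + 1) else 0).
Proof.
move=> vf /(coords_space _ _ _ vf) fS.
have f0 i : ~ (bigolin_window p q k i /\ d + (i %% 2)%Z = bigolin_degree p q k) ->
    f i = 0.
  by rewrite -region_vertex; exact: fS.
rewrite /bigolin_diff; case: ifP => [kpq|kpq].
  apply: (coords_eq (coords_proj _ (coords_dtot vf))) => i /=.
  rewrite /path_vertex in_box /bigolin_window (ltW kpq).
  by rewrite -if_and; congr (if _ then _ else _); lia.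
case: ifP => [/eqP kE|kE].
  rewrite zigzag_del_delbar; apply: (coords_eq coords0) => i /=.
  case: ifP => // /and3P[_ iw i1].
  rewrite !f0 ?subrr //; move: iw; rewrite /bigolin_window /bigolin_degree;
    case: ifP; lia.
apply: (coords_eq (coords_dtot vf)) => i /=.
case: (boolP (bigolin_window p q k i)) => iw /=; first by [].
rewrite andbF; case: ifP => // /andP[_ i1].
rewrite !f0 ?subrr //; move: iw; rewrite /bigolin_window /bigolin_degree;
  case: ifP; lia.
Qed.

Lemma bigolin_01_gen p q k (z : B) : bigolin_cocycles p q k z ->
  (forall c, bigolin_coboundaries p q k (c *: z) -> c = 0) ->
  (forall w, bigolin_cocycles p q k w -> exists c,
    bigolin_coboundaries p q k (w - c *: z)) ->
  bigolin_01 B p q k true.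
Proof.
move=> zZ zn0 H; exists z; split=> // w /H[c wc]; exists c; split=> // c' wc'.
apply/esym/eqP; rewrite -subr_eq0; apply/eqP/zn0.
have := bigolin_coboundaries_lin (-1) wc' wc.
congr (bigolin_coboundaries _ _ _ _).
by rewrite scaleN1r opprB addrA subrK scalerBl.
Qed.

(** * Cohomology of a zigzag cut down to a window *)

Section Window.
Variables p q k a' b' : int.
Hypothesis winE : forall i : int, (rng i && bigolin_window p q k i) = (a' <= i <= b').

Lemma coords_cocycle w f : coords w f -> bigolin_cocycles p q k w <->
  [/\ forall i : int, ~~ (a' <= i <= b') -> f i = 0,
      forall i, d + (i %% 2)%Z <> bigolin_degree p q k -> f i = 0 &
      forall i : int, a' <= i <= b' -> (i %% 2)%Z = 1 -> f (i - 1) = f (i + 1)].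
Proof.
move=> wf; split=> [[wS dw]|[f1 f2 f3]].
  have := coords_diff wf wS; rewrite dw => /(coords_uniq coords0) df.
  move/(coords_space _ _ _ wf): wS => fS.
  split=> i; last 1 first.
  - rewrite -winE => iw /eqP i1; apply/eqP; rewrite -subr_eq0 (df i) andbA iw i1.
    by [].
  - rewrite -winE negb_and => /orP[/wf.2 //|/negP iw].
    by apply: fS => /region_vertex[].
  - by move=> id; apply: fS => /region_vertex[].
have wS : bigolin_space p q k w.
  apply/(coords_space _ _ _ wf) => i; rewrite region_vertex => /not_andP[/negP iw|/f2 //].
  by apply: f1; rewrite -winE negb_and iw orbT.
split=> //; apply: (coords_ext (coords_diff wf wS)).
apply: (coords_eq coords0) => i /=; rewrite andbA winE; case: ifP => // /andP[iw /eqP i1].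
by rewrite f3 // subrr.
Qed.

(* Cocycles in degree d have equal coefficients at consecutive even vertices of
   the window, and coefficient 0 at an end next to an odd vertex. *)
Lemma zigzag_kernel : bigolin_degree p q k = d ->
  bigolin_01 B p q k [&& a' <= b', (a' %% 2)%Z == 0 & (b' %% 2)%Z == 0].
Proof.
move=> degE.
(* The preceding term has total degree below [d], where the zigzag is zero. *)
have Y0 (y : B) : bigolin_coboundaries p q k y -> y = 0.
  move=> [u uS <-]; have [g ug] := coords_ex u.
  rewrite (_ : u = 0) ?linear0 //; apply: (coords_ext ug).
  apply: (coords_eq coords0) => i; apply/esym.
  move/(coords_space _ _ _ ug): uS; apply => /region_vertex[_].
  by move: degE; rewrite /bigolin_degree; case: ifP; case: ifP; lia.
case: (boolP [&& a' <= b', (a' %% 2)%Z == 0 & (b' %% 2)%Z == 0])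
  => [/and3P[ab a0 b0]|nab].
  pose f i : R[i] := if ((i %% 2)%Z == 0) && (a' <= i <= b') then 1 else 0.
  have [i im|z zf] := @coords_build f.
    rewrite /f -winE; move: im; case: (rng i) => //= _; by rewrite andbF.
  apply: (@bigolin_01_gen _ _ _ z).
  - apply/(coords_cocycle zf); split=> i; rewrite /f.
    + by move=> /negbTE ->; rewrite andbF.
    + by rewrite degE; case: ifP => //; lia.
    + by move=> ii i1; case: ifP; case: ifP => //; lia.
  - move=> c /Y0 cz; have := coordsZD c zf coords0.
    rewrite cz addr0 => /(coords_uniq coords0)/(_ a').
    by rewrite /f a0 lexx ab mulr1 addr0.
  - move=> w wZ; have [g wg] := coords_ex w; exists (g a').
    have [g1 g2 g3] := (coords_cocycle wg).1 wZ.
    rewrite (_ : _ - _ = 0); first exact: bigolin_coboundaries0.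
    rewrite addrC -scaleNr; apply: (coords_ext (coordsZD _ zf wg)).
    apply: (coords_eq coords0) => i; rewrite /f.
    case: (boolP (a' <= i <= b')) => iab; last first.
      by rewrite andbF mulr0 add0r g1.
    case: eqP => i0; last by rewrite mulr0 add0r g2 // degE; lia.
    rewrite mulr1; apply/eqP; rewrite eq_sym addrC subr_eq0; apply/eqP.
    have -> : i = 2 * (i %/ 2)%Z by lia.
    have -> : a' = 2 * (a' %/ 2)%Z by lia.
    apply/esym/constant_steps; first lia.
    move=> j ij; have -> : 2 * j = (2 * j + 1) - 1 by lia.
    rewrite g3; [congr g| |]; lia.
move=> w wZ; have [g wg] := coords_ex w.
have [g1 g2 g3] := (coords_cocycle wg).1 wZ.
rewrite (_ : w = 0); first exact: bigolin_coboundaries0.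
apply: (coords_ext wg); apply: (coords_eq coords0) => i; apply/esym.
case: (boolP (a' <= i <= b')) => iab; last exact: g1.
case: (pselect ((i %% 2)%Z = 0)) => i0; last by rewrite g2 // degE; lia.
have iE : i = 2 * (i %/ 2)%Z by lia.
have [par|par] : (a' %% 2)%Z = 1 \/ (b' %% 2)%Z = 1 by lia.
  rewrite iE -(@constant_steps _ g (a' %/ 2)%Z).
  - by apply: g1; lia.
  - lia.
  - move=> j ij; have -> : 2 * j = (2 * j + 1) - 1 by lia.
    rewrite g3; [congr g| |]; lia.
rewrite iE (@constant_steps _ g _ ((b' + 1) %/ 2)%Z).
- by apply: g1; lia.
- lia.
- move=> j ij; have -> : 2 * j = (2 * j + 1) - 1 by lia.
  rewrite g3; [congr g| |]; lia.
Qed.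

(** The delicate case is [k = p + q + 1], where the preceding term lies on the other side of
    [del delbar], in degree [d - 1], and contributes nothing. Then [d = k], the window is at most
    the vertex [2 * p + 1], and the right-hand side is zero too because [g] vanishes at both
    neighbours. *)
Lemma coords_coboundary w f : bigolin_degree p q k = d + 1 -> coords w f ->
  bigolin_coboundaries p q k w <-> exists g : int -> R[i],
    (forall i : int, ~~ ((a' <= i <= b') && ((i %% 2)%Z == 0)) -> g i = 0) /\
    forall i : int, f i =
      if (a' <= i <= b') && ((i %% 2)%Z == 1) then g (i - 1) - g (i + 1) else 0.
Proof.
move=> degE wf.
have sameside : k <> p + q + 1 -> bigolin_degree p q (k - 1) = d /\
    bigolin_window p q (k - 1) = bigolin_window p q k.
  move: degE; rewrite /bigolin_degree /bigolin_window => degE kpq.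
  have -> : (k - 1 <= p + q) = (k <= p + q) by lia.
  by split=> //; move: degE; case: ifP; lia.
have otherside : k = p + q + 1 -> bigolin_degree p q (k - 1) = d - 1 /\
    forall i, a' <= i <= b' -> i = 2 * p + 1.
  move: degE winE; rewrite /bigolin_degree /bigolin_window => degE winE' kpq.
  split=> [|i]; first by move: degE; case: ifP; case: ifP; lia.
  by rewrite -winE'; move: degE; case: ifP; lia.
split=> [[u uS uw]|[g [g0 fg]]].
  have [g ug] := coords_ex u; exists g.
  have := coords_diff ug uS; rewrite uw => /(coords_uniq wf) fE.
  move/(coords_space _ _ _ ug): uS => gS.
  case: (pselect (k = p + q + 1)) => [/otherside[deg1 _]|/sameside[deg1 win1]].
    have gz i : g i = 0.
      by apply: gS => /region_vertex; rewrite deg1; lia.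
    by split=> // i; rewrite fE !gz subrr !if_same.
  split=> i; last by rewrite fE win1 andbA winE.
  case: (boolP (rng i)) => im; last by move=> _; exact: ug.2.
  move=> ni; apply: gS => /region_vertex; rewrite win1 deg1 => -[iw id].
  by case/negP: ni; rewrite -winE im iw; lia.
have [i|u ug] := @coords_build g.
  by move=> im; apply: g0; rewrite -winE (negbTE im).
have uS : bigolin_space p q (k - 1) u.
  apply/(coords_space _ _ _ ug) => i; rewrite region_vertex => nreg.
  apply: g0; apply/negP => /andP[iab /eqP i0]; apply: nreg.
  case: (pselect (k = p + q + 1)) => [/otherside[_ /(_ _ iab)]|/sameside[-> ->]].
    lia.
  by move: iab; rewrite -winE => /andP[_ ->]; split=> //; lia.
exists u => //; apply: (coords_ext (coords_diff ug uS)).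
apply: (coords_eq wf) => i; rewrite fg andbA.
case: (pselect (k = p + q + 1)) => [/otherside[_ ab1]|/sameside[_ ->]];
  last by rewrite winE.
rewrite !g0 ?subrr ?if_same //; apply/negP => /andP[/ab1]; lia.
Qed.

(* In degree d + 1 the coboundaries are the discrete derivatives of the functions
   on the even vertices; if both ends of the window are odd, such a function
   vanishes beyond both of them, and the sum of the coefficients is the only
   obstruction. *)
Lemma zigzag_cokernel : bigolin_degree p q k = d + 1 ->
  bigolin_01 B p q k [&& a' <= b', (a' %% 2)%Z == 1 & (b' %% 2)%Z == 1].
Proof.
move=> degE; case: (boolP [&& a' <= b', (a' %% 2)%Z == 1 & (b' %% 2)%Z == 1])
  => [/and3P[ab a1 b1]|nab].
  pose f i : R[i] := if i == a' then 1 else 0.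
  have [i im|z zf] := @coords_build f.
    rewrite /f; case: eqP => // ia; move: im; rewrite ia.
    by have := winE a'; rewrite lexx ab => /andP[->].
  have aE : a' = 2 * (a' %/ 2)%Z + 1 by lia.
  have bE : b' = 2 * ((b' + 1) %/ 2)%Z - 1 by lia.
  set e0 := (a' %/ 2)%Z in aE; set e1 := ((b' + 1) %/ 2)%Z in bE.
  clearbody e0 e1.
  apply: (@bigolin_01_gen _ _ _ z).
  - apply/(coords_cocycle zf); split=> i; rewrite /f.
    + by move=> ni; case: eqP => // ia; lia.
    + by rewrite degE => ?; case: eqP => // ia; lia.
    + by move=> ii i1; case: eqP; case: eqP => //; lia.
  - move=> c; have czf := coordsZD c zf coords0; rewrite addr0 in czf.
    move/(coords_coboundary degE czf) => [g [g0 gE]].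
    (* Away from [a'] the function [g] does not change between consecutive even vertices. As it
       vanishes at [a' - 1] and at [b' + 1], its jump [c] at [a'] is zero. *)
    have := gE a'; rewrite /f eqxx lexx ab a1 mulr1 addr0 => ->.
    rewrite (g0 (a' - 1)); last by lia.
    have -> : a' + 1 = 2 * (e0 + 1) by lia.
    rewrite (@constant_steps _ g _ e1); first by rewrite g0 ?subrr //; lia.
      lia.
    move=> j ij; have := gE (2 * j + 1).
    rewrite /f ifF; last by apply/eqP; lia.
    rewrite mulr0 addr0 ifT; last by lia.
    have -> : 2 * j + 1 - 1 = 2 * j by lia.
    have -> : 2 * j + 1 + 1 = 2 * j + 2 by lia.
    by move/esym/eqP; rewrite subr_eq0 => /eqP.
  - move=> w wZ; have [h wh] := coords_ex w.
    have [h1 h2 _] := (coords_cocycle wh).1 wZ.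
    have [G [G0 GS]] := antidifference (fun e => h (2 * e + 1)) e0.
    (* [- G e1] is the sum of the coefficients of [w]. Shifting [G] by it makes the primitive vanish
       beyond the right end; the defect at the left end is absorbed by [c *: z]. *)
    pose c := - G e1; exists c.
    have wcz : coords (w - c *: z) (fun i => - c * f i + h i).
      by rewrite addrC -scaleNr; exact: coordsZD.
    apply/(coords_coboundary degE wcz).
    exists (fun i => if (a' <= i <= b') && ((i %% 2)%Z == 0) then G (i %/ 2)%Z + c
                     else 0).
    split=> i; first by move=> /negbTE ->.
    case: ifP => [/andP[iab i1]|ni]; last first.
      rewrite /f ifF; last by apply/eqP; lia.
      rewrite mulr0 add0r; case: (boolP (a' <= i <= b')) => iab; last exact: h1.
      by apply: h2; rewrite degE; lia.
    have [e ie] : exists e, i = 2 * e + 1 by exists (i %/ 2)%Z; lia.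
    have Ge := GS e; rewrite -ie in Ge.
    have d1 : ((i - 1) %/ 2)%Z = e by lia.
    have d2 : ((i + 1) %/ 2)%Z = e + 1 by lia.
    rewrite d1 d2.
    have -> : (if (a' <= i + 1 <= b') && (((i + 1) %% 2)%Z == 0) then G (e + 1) + c
              else 0) = G (e + 1) + c.
      case: ifP => // H; have -> : e + 1 = e1 by lia.
      by rewrite /c subrr.
    rewrite Ge /f; case: eqP => ia.
      rewrite ifF; last by lia.
      have -> : e = e0 by lia.
      by rewrite G0; ring.
    rewrite ifT; last by lia.
    ring.
move=> w wZ; have [h wh] := coords_ex w.
have [h1 h2 _] := (coords_cocycle wh).1 wZ.
(* A nonempty window has at most one odd end here. The base point is the even vertex just beyond
   that end, where the primitive must vanish; an even end imposes no condition. *)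
have [G [G0 GS]] := antidifference (fun e => h (2 * e + 1))
  (if (b' %% 2)%Z == 1 then ((b' + 1) %/ 2)%Z else (a' %/ 2)%Z).
apply/(coords_coboundary degE wh).
exists (fun i => if (a' <= i <= b') && ((i %% 2)%Z == 0) then G (i %/ 2)%Z else 0).
split=> i; first by move=> /negbTE ->.
case: ifP => [/andP[iab i1]|ni]; last first.
  case: (boolP (a' <= i <= b')) => iab; last exact: h1.
  by apply: h2; rewrite degE; lia.
have [e ie] : exists e, i = 2 * e + 1 by exists (i %/ 2)%Z; lia.
have Ge := GS e; rewrite -ie in Ge.
have d1 : ((i - 1) %/ 2)%Z = e by lia.
have d2 : ((i + 1) %/ 2)%Z = e + 1 by lia.
rewrite d1 d2.
have -> : (if (a' <= i + 1 <= b') && (((i + 1) %% 2)%Z == 0) then G (e + 1) else 0)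
    = G (e + 1).
  case: ifP => // H; rewrite -G0; congr G; case: ifP; lia.
have -> : (if (a' <= i - 1 <= b') && (((i - 1) %% 2)%Z == 0) then G e else 0) = G e.
  case: ifP => // H; rewrite -G0; congr G; case: ifP; lia.
by rewrite Ge; ring.
Qed.

End Window.

Lemma zigzag_other_degree p q k : bigolin_degree p q k <> d ->
  bigolin_degree p q k <> d + 1 -> bigolin_01 B p q k false.
Proof.
move=> d0 d1 w [wS _]; have [f wf] := coords_ex w.
rewrite (_ : w = 0); first exact: bigolin_coboundaries0.
apply: (coords_ext wf); apply: (coords_eq coords0) => i; apply/esym.
move/(coords_space _ _ _ wf): wS; apply => /region_vertex; lia.
Qed.

End ZigzagCoords.

(* The Bigolin number of the zigzag [odd_zigzag_set u v D] (see below). *)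
Definition odd_bit (u v D p q k : int) : bool :=
  [&& k == D, u <= p & v <= q] || [&& k == D - 1, p < u & q < v].

(* The Bigolin number of the zigzag with vertices a, ..., b on the path of total
   degrees d and d + 1. *)
Definition zigzag_bit (d a b p q k : int) : bool :=
  if (a %% 2)%Z == 0 then
    if (b %% 2)%Z == 0 then odd_bit (a %/ 2)%Z (d - (b %/ 2)%Z) d p q k
    else (k == d) && (a <= 2 * p <= b)
  else if (b %% 2)%Z == 0 then (k == d) && (a <= 2 * (d - q) <= b)
  else odd_bit ((b + 1) %/ 2)%Z (d - ((a - 1) %/ 2)%Z) (d + 1) p q k.

(** The zigzag meets the window in an interval whose ends come from the zigzag or from the quadrant.
    The quadrant ends are even up to [k = p + q] and odd afterwards, so only the parities of the
    ends of the zigzag remain to be distinguished. *)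
Lemma zigzag_01 (R : realType) (B : double_complex R) d a m p q k :
  (0 < m)%N -> thin (zigzag_set d a m) B ->
  bigolin_01 B p q k (zigzag_bit d a (a + m%:Z - 1) p q k).
Proof.
move=> m0 tB; have [X [XB Xn0 delX delbarX]] := zigzag_basis tB m0.
have [lo loE] : exists lo, lo = if k <= p + q then 2 * (d - q) else 2 * p + 1 by eexists.
have [hi hiE] : exists hi, hi = if k <= p + q then 2 * p else 2 * (d - q) - 1 by eexists.
pose a' := if a <= lo then lo else a.
pose b' := if a + m%:Z - 1 <= hi then a + m%:Z - 1 else hi.
have winE (i : int) : (a <= i < a + m%:Z) && @bigolin_window d p q k i = (a' <= i <= b').
  have -> : @bigolin_window d p q k i = (lo <= i <= hi).
    by rewrite loE hiE /bigolin_window; case: ifP.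
  by rewrite /a' /b'; case: ifP; case: ifP; lia.
have degE : bigolin_degree p q k = if k <= p + q then k else k + 1 by [].
case: (pselect (bigolin_degree p q k = d)) => [dk|nd].
  have := zigzag_kernel tB XB Xn0 delX delbarX winE dk.
  congr bigolin_01; rewrite /zigzag_bit /odd_bit /a' /b'.
  move: dk loE hiE; rewrite degE; case: ifP => kpq dk loE hiE.
    by case: ifP => Ha; case: ifP => Hb; case: ifP => Hc; case: ifP => Hd; lia.
  by case: ifP => Ha; case: ifP => Hb; case: ifP => Hc; case: ifP => Hd; lia.
case: (pselect (bigolin_degree p q k = d + 1)) => [dk|nd1].
  have := zigzag_cokernel tB XB Xn0 delX delbarX winE dk.
  congr bigolin_01; rewrite /zigzag_bit /odd_bit /a' /b'.
  move: dk loE hiE; rewrite degE; case: ifP => kpq dk loE hiE.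
    by case: ifP => Ha; case: ifP => Hb; case: ifP => Hc; case: ifP => Hd; lia.
  by case: ifP => Ha; case: ifP => Hb; case: ifP => Hc; case: ifP => Hd; lia.
have := zigzag_other_degree tB XB Xn0 nd nd1.
congr bigolin_01; rewrite /zigzag_bit /odd_bit.
move: nd nd1; rewrite degE; case: ifP => kpq nd nd1.
  by case: ifP => Ha; case: ifP => Hb; lia.
by case: ifP => Ha; case: ifP => Hb; lia.
Qed.

(* The odd zigzags correspond to the triples (u, v, D), where D is the total
   degree carrying one vertex more and u, v are the smallest coordinates
   (if u + v <= D) or the largest ones (if u + v >= D) of its vertices. *)
Definition odd_zigzag_set (u v D : int) : set (int * int) := [set rs |
  (rs.1 + rs.2 = D /\
    ((u <= rs.1 /\ v <= rs.2) \/ (rs.1 <= u /\ rs.2 <= v))) \/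
  (rs.1 + rs.2 = D + 1 /\ u < rs.1 /\ v < rs.2) \/
  (rs.1 + rs.2 = D - 1 /\ rs.1 < u /\ rs.2 < v)].

Lemma odd_zigzagP d a m : odd m ->
  exists u v D : int, zigzag_set d a m = odd_zigzag_set u v D.
Proof.
move=> om; rewrite /odd_zigzag_set; case: (boolP ((a %% 2)%Z == 0)) => a2.
  exists (a %/ 2)%Z, (d - ((a + m%:Z - 1) %/ 2)%Z), d.
  by apply/seteqP; split=> -[r s]; rewrite zigzag_setE /=; lia.
exists ((a + m%:Z) %/ 2)%Z, (d - ((a - 1) %/ 2)%Z), (d + 1).
by apply/seteqP; split=> -[r s]; rewrite zigzag_setE /=; lia.
Qed.

Lemma even_zigzag_bit d a m : (0 < m)%N -> ~~ odd m ->
  (exists lo hi : int, forall p q k : int, zigzag_bit d a (a + m%:Z - 1) p q k =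
     (k == d) && (lo <= p <= hi)) \/
  (exists lo hi : int, forall p q k : int, zigzag_bit d a (a + m%:Z - 1) p q k =
     (k == d) && (lo <= q <= hi)).
Proof.
move=> m0 em; rewrite /zigzag_bit.
case: (boolP ((a %% 2)%Z == 0)) => a2; [left|right].
  exists (a %/ 2)%Z, ((a + m%:Z - 1) %/ 2)%Z => p q k.
  by rewrite ifF; lia.
exists (d - ((a + m%:Z - 1) %/ 2)%Z), (d - ((a + 1) %/ 2)%Z) => p q k.
by rewrite ifT; lia.
Qed.

Lemma odd_zigzag_setE u v D : exists d a m, [/\ odd m,
  zigzag_set d a m = odd_zigzag_set u v D &
  forall p q k, zigzag_bit d a (a + m%:Z - 1) p q k = odd_bit u v D p q k].
Proof.
rewrite /zigzag_bit /odd_zigzag_set; case: (boolP (u + v <= D)) => uv.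
  exists D, (2 * u), (2 * `|(D - v)%R - u|%N + 1)%N; split; first lia.
    by apply/seteqP; split=> -[r s]; rewrite zigzag_setE /=; lia.
  by move=> p q k; rewrite ifT ?ifT; rewrite /odd_bit; lia.
exists (D - 1), (2 * (D - 1 - v) + 1), (2 * `|(u + v)%R - D|%N + 1)%N; split; first lia.
  by apply/seteqP; split=> -[r s]; rewrite zigzag_setE /=; lia.
by move=> p q k; rewrite ifF ?ifF; rewrite /odd_bit; lia.
Qed.

(** * Recovering the odd multiplicities *)

Section Thin.
Context {R : realType}.
Implicit Types B : double_complex R.

Lemma thin_unique S S' B : thin S B -> thin S' B -> S = S'.
Proof.
suff sub T T' : thin T B -> thin T' B -> T `<=` T'.
  by move=> tS tS'; apply/seteqP; split; exact: sub.
move=> [TB _ _ _] [_ T'B _ _] pq Tpq; apply: contrapT => nT'.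
have [e [eB en0 _]] := quotient_dim0_1 (TB _ Tpq).
by rewrite T'B // in eB; rewrite eB eqxx in en0.
Qed.

Lemma bigolin_01_inj B p q k b b' :
  bigolin_01 B p q k b -> bigolin_01 B p q k b' -> b = b'.
Proof.
have absurd : bigolin_01 B p q k true -> bigolin_01 B p q k false -> False.
  move=> [z [zZ zU]] Y; have zY := Y _ zZ.
  have [c [_ cU]] := zU _ zZ; have /eqP := @oner_neq0 R[i].
  rewrite -(cU 0) => [|]; last by rewrite scale0r subr0.
  rewrite (cU 1) => [//|]; rewrite scale1r subrr.
  exact: bigolin_coboundaries0.
by case: b b' => -[] // H H'; case: absurd.
Qed.

Lemma odd_zigzag_01 B u v D p q k : thin (odd_zigzag_set u v D) B ->
  bigolin_01 B p q k (odd_bit u v D p q k).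
Proof.
have [d [a [m [om <- <-]]]] := odd_zigzag_setE u v D.
by move=> tB; apply: zigzag_01; first exact: odd_gt0.
Qed.

(** Evaluating the Bigolin numbers of each zigzag at the data of the other gives inequalities in
    both directions. *)
Lemma odd_zigzag_inj B u v D u' v' D' : thin (odd_zigzag_set u v D) B ->
  thin (odd_zigzag_set u' v' D') B -> [/\ u = u', v = v' & D = D'].
Proof.
move=> H H'.
have E p q k := bigolin_01_inj (odd_zigzag_01 p q k H) (odd_zigzag_01 p q k H').
move: (E u v D) (E u' v' D'); rewrite /odd_bit.
by split; lia.
Qed.

(** An odd zigzag has nonzero Bigolin numbers in both degrees [D] and [D - 1], an even one in degree
    [d] only. *)
Lemma odd_even_zigzag B u v D d a m : (0 < m)%N -> ~~ odd m ->
  thin (zigzag_set d a m) B -> ~ thin (odd_zigzag_set u v D) B.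
Proof.
move=> m0 em H H'.
have E p q k := bigolin_01_inj (odd_zigzag_01 p q k H') (zigzag_01 p q k m0 H).
move: (E u v D) (E (u - 1) (v - 1) (D - 1)); rewrite /odd_bit.
by case: (even_zigzag_bit d a m0 em) => -[lo [hi bE]]; rewrite !bE; lia.
Qed.

Definition is_odd_zigzag B u v D : bool :=
  `[< is_zigzag (odd_zigzag_set u v D) B >].

Lemma odd_zigzag_support u v D : exists m, zigzag_support m (odd_zigzag_set u v D).
Proof.
have [d [a [m [om E _]]]] := odd_zigzag_setE u v D.
by exists m; split; [exact: odd_gt0|exists d, a].
Qed.

Lemma is_odd_zigzagP B u v D :
  reflect (thin (odd_zigzag_set u v D) B) (is_odd_zigzag B u v D).
Proof.
by apply: (iffP (asboolP _)) => [[] //|tB]; split=> //; exact: odd_zigzag_support.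
Qed.

Definition bigolin_bit B (p q k : int) : bool := `[< bigolin_01 B p q k true >].

Lemma bigolin_bitE B p q k b : bigolin_01 B p q k b -> bigolin_bit B p q k = b.
Proof.
rewrite /bigolin_bit => Hb; apply/asboolP/idP => [|bT]; last by rewrite bT in Hb.
by move=> /(bigolin_01_inj Hb).
Qed.

(** The split is on being a zigzag, so squares come with the information that they contribute to no
    multiplicity. *)
Lemma elementary_cases B : is_square B \/ (exists S, is_zigzag S B) ->
  [\/ is_square B /\ (forall S, ~ is_zigzag S B),
      exists d a m, [/\ (0 < m)%N, ~~ odd m & thin (zigzag_set d a m) B] |
      exists u v D, thin (odd_zigzag_set u v D) B].
Proof.
move=> BE; case: (pselect (exists S, is_zigzag S B)) => [|nz]; last first.
  by constructor 1; split=> [|S zS]; [case: BE|apply: nz; exists S].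
move=> [S [[m [m0 [d [a E]]]] tB]].
have {}E : S = zigzag_set d a m := E; rewrite {}E in tB.
case: (boolP (odd m)) => om; last by constructor 2; exists d, a, m.
have [u [v [D E]]] := odd_zigzagP d a om.
by constructor 3; exists u, v, D; rewrite -E.
Qed.

Lemma elementary_01 B p q k : is_square B \/ (exists S, is_zigzag S B) ->
  bigolin_01 B p q k (bigolin_bit B p q k).
Proof.
move=> /elementary_cases[[[a [b tB]] _]|[d [a [m [m0 _ tB]]]]|[u [v [D tB]]]].
- have H := square_acyclic tB p q k; by rewrite (bigolin_bitE H).
- have H := zigzag_01 p q k m0 tB; by rewrite (bigolin_bitE H).
- have H := odd_zigzag_01 p q k tB; by rewrite (bigolin_bitE H).
Qed.

(** Subtractions are moved across the equality so that it can be summed over a list of summands in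
    [nat]. *)
Lemma second_difference B p q k : is_square B \/ (exists S, is_zigzag S B) ->
  (bigolin_bit B (p + 1) (q + 1) k + bigolin_bit B p q k =
   bigolin_bit B (p + 1) q k + bigolin_bit B p (q + 1) k +
   is_odd_zigzag B (p + 1) (q + 1) k + is_odd_zigzag B (p + 1) (q + 1) (k + 1))%N.
Proof.
move=> /elementary_cases[[[a [b tB]] nz]|[d [a [m [m0 em tB]]]]|[u [v [D tB]]]].
- have E p' q' k' : bigolin_bit B p' q' k' = false.
    exact/bigolin_bitE/(square_acyclic tB).
  have O u v D : is_odd_zigzag B u v D = false.
    by apply/negbTE/asboolPn; exact: nz.
  by rewrite !E !O.
- have E p' q' k' := bigolin_bitE (zigzag_01 p' q' k' m0 tB).
  have O u v D : is_odd_zigzag B u v D = false.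
    by apply/negbTE/is_odd_zigzagP; exact: odd_even_zigzag m0 em tB.
  rewrite !E !O; case: (even_zigzag_bit d a m0 em) => -[lo [hi bE]]; rewrite !bE; lia.
- have E p' q' k' := bigolin_bitE (odd_zigzag_01 p' q' k' tB).
  have O u' v' D' : is_odd_zigzag B u' v' D' = [&& u == u', v == v' & D == D'].
    apply/is_odd_zigzagP/and3P => [/(odd_zigzag_inj tB)[-> -> ->] //|].
    by move=> [/eqP<- /eqP<- /eqP<-].
  (* Once equalities are expressed by comparisons, the identity depends on six truth values only and
     is checked on all of them. *)
  rewrite !E !O /odd_bit !ltNge.
  have -> : (u == p + 1) = (u <= p + 1) && ~~ (u <= p) by lia.
  have -> : (v == q + 1) = (v <= q + 1) && ~~ (v <= q) by lia.
  have -> : (D == k + 1) = (k == D - 1) by lia.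
  rewrite [D == k]eq_sym.
  have : (u <= p) ==> (u <= p + 1) by lia.
  have : (v <= q) ==> (v <= q + 1) by lia.
  have : ~~ ((k == D) && (k == D - 1)) by lia.
  by case: (u <= p) (u <= p + 1) (v <= q) (v <= q + 1) (k == D) (k == D - 1)
    => -[] [] [] [] [].
Qed.

Lemma finite_zigzag_seq (A : double_complex R) (D : decomposition A) :
  finitely_many_zigzags D -> exists2 s : seq (dec_index D), uniq s &
    forall i, i \notin s -> forall S, ~ is_zigzag S (summand i).
Proof.
move=> /finite_uniq_seq[s us Es]; exists s => // i si S zS.
case/negP: si; rewrite -[i \in s : Prop]/([set` s] i) -Es.
by exists S.
Qed.

Lemma card_zigzag_summands (A : double_complex R) (D : decomposition A) s S :
  uniq s -> (forall i : dec_index D, i \notin s -> ~ is_zigzag S (summand i)) ->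
  zigzag_summands D S #= `I_(count (fun i => `[< is_zigzag S (summand i) >]) s).
Proof.
move=> us Hs; rewrite -size_filter.
have -> : zigzag_summands D S =
    [set` [fset i | i in filter (fun i => `[< is_zigzag S (summand i) >]) s]%fset].
  apply/seteqP; split=> i /=; rewrite !inE mem_filter.
    move=> zi; apply/andP; split; first exact/asboolP.
    by apply: contrapT => /negP/Hs.
  by move=> /andP[/asboolP].
apply/card_eq_fsetP; rewrite card_fseq undup_id //; exact: filter_uniq.
Qed.

Lemma bigolin_number_zigzags (A : double_complex R) (D : decomposition A) s p q k :
  uniq s -> (forall i, i \notin s -> forall S, ~ is_zigzag S (summand i)) ->
  bigolin_number A p q k =
    Some (count (fun i : dec_index D => bigolin_bit (summand i) p q k) s).
Proof.
move=> us Hs; apply: bigolin_number_count => // i.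
  move=> /Hs nz; have [[a [b tB]]|[S /nz]] := summand_elementary i; last by [].
  by rewrite (bigolin_bitE (square_acyclic tB p q k)).
exact/elementary_01/summand_elementary.
Qed.

(** This supplies the start of the downward induction: a summand has at most one triple of data, so
    a finite list has a largest degree. *)
Lemma odd_degree_bound (I : eqType) (s : seq I) (B : I -> double_complex R) :
  exists K : int, forall i, i \in s -> forall u v D, is_odd_zigzag (B i) u v D -> D <= K.
Proof.
elim: s => [|i s [K HK]]; first by exists 0.
have [K' HK'] : exists K', forall u v D, is_odd_zigzag (B i) u v D -> D <= K'.
  case: (pselect (exists t, is_odd_zigzag (B i) t.1.1 t.1.2 t.2))
    => [[t /is_odd_zigzagP Ht]|H].
    exists t.2 => u v D /is_odd_zigzagP Hu.
    by have [_ _ ->] := odd_zigzag_inj Hu Ht.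
  by exists 0 => u v D Hu; case: H; exists (u, v, D).
exists (if K <= K' then K' else K) => j; rewrite inE => /orP[/eqP->|js] u v D.
  by move=> /HK'; case: ifP; lia.
by move=> /(HK _ js); case: ifP; lia.
Qed.

Lemma odd_multiplicities (A1 A2 : double_complex R)
    (D1 : decomposition A1) (D2 : decomposition A2) :
  finitely_many_zigzags D1 -> finitely_many_zigzags D2 ->
  same_bigolin_numbers A1 A2 -> forall S, odd_support S ->
  zigzag_summands D1 S #= zigzag_summands D2 S.
Proof.
move=> /finite_zigzag_seq[s1 us1 H1] /finite_zigzag_seq[s2 us2 H2] same S [m om].
move=> [m0 [d [a ES]]]; have {}ES : S = zigzag_set d a m := ES.
have [u [v [D E]]] := odd_zigzagP d a om; rewrite {}ES {}E {d a m om m0}.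
pose N (A : double_complex R) (D : decomposition A) s u v k :=
  count (fun i : dec_index D => is_odd_zigzag (summand i) u v k) s.
pose h (A : double_complex R) (D : decomposition A) s p q k :=
  count (fun i : dec_index D => bigolin_bit (summand i) p q k) s.
have hN (A : double_complex R) (D' : decomposition A) s p q k :
    (h A D' s (p + 1)%R (q + 1)%R k + h A D' s p q k =
     h A D' s (p + 1)%R q k + h A D' s p (q + 1)%R k + N A D' s (p + 1)%R (q + 1)%R k
     + N A D' s (p + 1)%R (q + 1)%R (k + 1)%R)%N.
  rewrite /h /N; elim: s => //= i s IHs.
  by have := second_difference p q k (summand_elementary i); lia.
have hh p q k : h A1 D1 s1 p q k = h A2 D2 s2 p q k.
  have := same p q k.
  rewrite (bigolin_number_zigzags _ _ _ us1 H1).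
  by rewrite (bigolin_number_zigzags _ _ _ us2 H2) => -[].
have [K1 HK1] := odd_degree_bound s1 (fun i : dec_index D1 => summand i).
have [K2 HK2] := odd_degree_bound s2 (fun i : dec_index D2 => summand i).
have NN k : N A1 D1 s1 u v k = N A2 D2 s2 u v k.
  (* Induction on a number of steps that takes [k] beyond both bounds, where both counts are
     zero. *)
  have [n] : exists n : nat, K1 < k + n%:Z /\ K2 < k + n%:Z.
    by exists (`|K1 - k| + `|K2 - k| + 1)%N; lia.
  elim: n k => [|n IHn] k [k1 k2].
    rewrite /N (eq_in_count (a2 := pred0)); last first.
      by move=> i is1 /=; apply/negP => /(HK1 _ is1); lia.
    rewrite [RHS](eq_in_count (a2 := pred0)) ?count_pred0 //.
    by move=> i is2 /=; apply/negP => /(HK2 _ is2); lia.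
  (* At [(u - 1, v - 1)] the identity involves [N] only at the given [u] and [v], so these stay
     fixed in the induction. *)
  have := hN _ D1 s1 (u - 1) (v - 1) k; have := hN _ D2 s2 (u - 1) (v - 1) k.
  rewrite !subrK !hh (IHn (k + 1)); last by lia.
  lia.
have C1 := card_zigzag_summands us1 (fun i si => H1 i si (odd_zigzag_set u v D)).
have C2 := card_zigzag_summands us2 (fun i si => H2 i si (odd_zigzag_set u v D)).
apply: (card_eq_trans C1); rewrite card_eq_sym; apply: (card_eq_trans C2).
by have := NN D; rewrite /N /is_odd_zigzag => ->.
Qed.

End Thin.

(** * Finite direct sums of zigzags *)

Section Lines.
Context {R : realType} {V : lmodType R[i]}.

Lemma quotient_dim0_line (Z : set V) e : Z e -> e != 0 ->
  (forall z, Z z -> exists c : R[i], z = c *: e) -> quotient_dim Z [set 0] 1.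
Proof.
move=> Ze e0 He; exists (fun=> e); split=> // z /He[c ->].
exists (fun=> c); split=> [|c'] /=; first by rewrite big_ord1 subrr.
rewrite big_ord1 -scalerBl => /eqP; rewrite scaler_eq0 (negbTE e0) orbF subr_eq0.
by move=> /eqP ->; apply/funext => j; rewrite (ord1 j).
Qed.

Lemma set_bij_lines (Z W : set V) (f : {linear V -> V}) e e' : W e' -> e' != 0 ->
  (forall z, Z z <-> exists c : R[i], z = c *: e) ->
  (forall w, W w <-> exists c : R[i], w = c *: e') ->
  f e = e' -> set_bij Z W f.
Proof.
move=> We' e0 HZ HW fe; split.
- by move=> z /HZ[c ->]; apply/HW; exists c; rewrite linearZ /= fe.
- move=> z z'; rewrite !inE => /HZ[c ->] /HZ[c' ->].
  rewrite !linearZ /= fe => /eqP; rewrite -subr_eq0 -scalerBl scaler_eq0.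
  by rewrite (negbTE e0) orbF subr_eq0 => /eqP ->.
- by move=> w /HW[c ->]; exists (c *: e); [apply/HZ; exists c|rewrite linearZ /= fe].
Qed.

End Lines.

Section ZigzagSum.
Context {R : realType} {I : finType}.
Variables (k a : I -> int) (m : nat).
Local Notation T := (I * 'I_m)%type.
Local Notation V := {ffun T -> R[i]^o}.

Definition zpos (t : T) : int * int := path_vertex (k t.1) (a t.1 + t.2%:Z).

(** Every arrow has coefficient 1. Anticommutation needs no signs, because arrows run from even to
    odd vertices and all composites vanish. *)
Definition zmap (c : int -> nat -> nat -> bool) (f : V) : V :=
  [ffun t : T => \sum_(l < m | c (a t.1) l t.2) f (t.1, l)].

Definition right_edge (a0 : int) (l l' : nat) : bool :=
  (((a0 + l%:Z) %% 2)%Z == 0) && (l' == l.+1).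

Definition left_edge (a0 : int) (l l' : nat) : bool :=
  (((a0 + l%:Z) %% 2)%Z == 0) && (l == l'.+1).

Lemma zmap_linear c : linear (zmap c).
Proof.
move=> x f g; apply/ffunP => t; rewrite !ffunE scaler_sumr -big_split /=.
by apply: eq_bigr => l _; rewrite !ffunE.
Qed.

HB.instance Definition _ c := GRing.isLinear.Build R[i] V V _ (zmap c) (zmap_linear c).

Definition zbideg (pq : int * int) : set V :=
  [set f | forall t, zpos t <> pq -> f t = 0].

Lemma zbideg_submod pq : submod_closed [in zbideg pq].
Proof.
split=> [|x f g]; rewrite ?in_setE; first by move=> t _; rewrite ffunE.
by move=> Hf Hg t tpq; rewrite !ffunE Hf // Hg // scaler0 addr0.
Qed.

Lemma zbideg_direct (v : V) : exists! x : int * int -> V,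
  [/\ forall pq, zbideg pq (x pq), finite_set [set pq | x pq != 0] &
      v = \sum_(pq \in [set: int * int]) x pq].
Proof.
have sumE (y : int * int -> V) (s : seq (int * int)) t : uniq s ->
    (forall pq, zbideg pq (y pq)) -> (forall pq, pq \notin s -> y pq = 0) ->
    (\sum_(pq <- s) y pq) t = y (zpos t) t.
  move=> us yB y0; rewrite sum_ffunE.
  case: (boolP (zpos t \in s)) => ts; last first.
    rewrite y0 // ffunE big_seq big1 // => pq pqs.
    by apply: yB => tpq; rewrite tpq pqs in ts.
  rewrite (bigD1_seq (zpos t)) //= big1 ?addr0 // => pq npq.
  by apply: yB => tpq; rewrite tpq eqxx in npq.
pose x pq : V := [ffun t => if zpos t == pq then v t else 0].
have xB pq : zbideg pq (x pq) by move=> t tpq; rewrite ffunE; case: eqP.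
pose s := undup (codom zpos).
have x0 pq : pq \notin s -> x pq = 0.
  rewrite mem_undup => npq; apply/ffunP => t; rewrite !ffunE.
  by case: eqP => // tpq; rewrite -tpq codom_f in npq.
exists x; split; first split=> //.
- apply: (@sub_finite_set _ _ [set` s]); last exact: finite_seq.
  by move=> pq /=; apply: contraNT => /x0 ->.
- rewrite (fsum_seq (s := s)) ?undup_uniq //; apply/ffunP => t.
  by rewrite sumE ?undup_uniq // ffunE eqxx.
move=> y [yB /finite_uniq_seq[s' us' Es'] vy]; apply/funext => pq; apply/ffunP => t.
rewrite ffunE; case: eqP => [<-|tpq]; last by rewrite yB.
have y0 rs : rs \notin s' -> y rs = 0.
  move=> /negP; rewrite -[rs \in s' : Prop]/([set` s'] rs) -Es' /=.
  by case: eqVneq.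
by rewrite {1}vy (fsum_seq us') // sumE.
Qed.

Lemma zdel_bideg p q v : zbideg (p, q) v -> zbideg (p + 1, q) (zmap right_edge v).
Proof.
move=> vB [i l] tpq; rewrite ffunE big1 //= => l' /andP[par /eqP ll'].
apply: vB => /= e; apply: tpq; move: e; rewrite /zpos /= /path_vertex => -[e1 e2].
congr (_, _); lia.
Qed.

Lemma zdelbar_bideg p q v : zbideg (p, q) v -> zbideg (p, q + 1) (zmap left_edge v).
Proof.
move=> vB [i l] tpq; rewrite ffunE big1 //= => l' /andP[par /eqP ll'].
apply: vB => /= e; apply: tpq; move: e; rewrite /zpos /= /path_vertex => -[e1 e2].
congr (_, _); lia.
Qed.

Lemma zmap_zmap (c c' : int -> nat -> nat -> bool) v :
  (forall a0 l l', c a0 l l' -> ((a0 + l%:Z) %% 2)%Z == 0) ->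
  (forall a0 l l', c' a0 l l' -> ((a0 + l'%:Z) %% 2)%Z != 0) ->
  zmap c (zmap c' v) = 0.
Proof.
move=> Hc Hc'; apply/ffunP => -[i l]; rewrite !ffunE big1 // => l' /Hc e.
by rewrite ffunE big1 // => l'' /Hc'; rewrite e.
Qed.

Lemma edge_source a0 l l' :
  right_edge a0 l l' || left_edge a0 l l' -> ((a0 + l%:Z) %% 2)%Z == 0.
Proof. by rewrite /right_edge /left_edge; lia. Qed.

Lemma edge_target a0 l l' :
  right_edge a0 l l' || left_edge a0 l l' -> ((a0 + l'%:Z) %% 2)%Z != 0.
Proof. by rewrite /right_edge /left_edge; lia. Qed.

Lemma zmap_edges (c c' : int -> nat -> nat -> bool) v :
  (c = right_edge \/ c = left_edge) -> (c' = right_edge \/ c' = left_edge) ->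
  zmap c (zmap c' v) = 0.
Proof.
move=> Hc Hc'; apply: zmap_zmap => a0 l l' H.
  by apply: (@edge_source _ _ l'); case: Hc H => -> ->; rewrite ?orbT.
by apply: (@edge_target _ l); case: Hc' H => -> ->; rewrite ?orbT.
Qed.

Lemma zdel_del v : zmap right_edge (zmap right_edge v) = 0.
Proof. by apply: zmap_edges; left. Qed.

Lemma zdelbar_delbar v : zmap left_edge (zmap left_edge v) = 0.
Proof. by apply: zmap_edges; right. Qed.

Lemma zdel_delbar v :
  zmap right_edge (zmap left_edge v) + zmap left_edge (zmap right_edge v) = 0.
Proof. by rewrite !zmap_edges ?addr0; auto. Qed.

(* The direct sum of the zigzags of length m starting at the vertex a i of the
   path of total degrees k i and k i + 1. *)
Definition zigzag_sum : double_complex R := DoubleComplex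
  zbideg_submod zbideg_direct zdel_bideg zdelbar_bideg
  zdel_del zdelbar_delbar zdel_delbar.

End ZigzagSum.

Section ZigzagSumTheory.
Context {R : realType}.

Lemma zbideg_vanish (I : finType) (k a : I -> int) m pq :
  (forall t : I * 'I_m, zpos k a t <> pq) ->
  bideg (@zigzag_sum R I k a m) pq = [set 0].
Proof.
move=> H; apply/seteqP; split=> [v vB|_ ->]; last by move=> t _; rewrite ffunE.
by apply/ffunP => t; rewrite vB // ffunE.
Qed.

Section OneZigzag.
Variables (d a0 : int) (m : nat).
Let B := @zigzag_sum R unit (fun=> d) (fun=> a0) m.

Let delta (l : 'I_m) : B := [ffun t => (t.2 == l)%:R].

Lemma delta_neq0 l : delta l != 0.
Proof.
apply/eqP => /ffunP/(_ (tt, l)); rewrite !ffunE eqxx => /eqP.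
by rewrite oner_eq0.
Qed.

Lemma delta_bideg (l : 'I_m) : bideg B (path_vertex d (a0 + (l : nat)%:Z)) (delta l).
Proof.
by move=> [i l'] e; rewrite ffunE /=; case: eqP => // ll; case: e; rewrite ll.
Qed.

Arguments delta_bideg : clear implicits.

Lemma bideg_delta (l : 'I_m) v : bideg B (path_vertex d (a0 + (l : nat)%:Z)) v <->
  exists c : R[i], v = c *: delta l.
Proof.
split=> [vB|[c ->]]; last exact/bidegZ/delta_bideg.
exists (v (tt, l)); apply/ffunP => -[[] l']; rewrite !ffunE /=.
case: eqP => [->|ll]; first by rewrite [RHS]mulr1.
rewrite scaler0; apply: vB; rewrite /zpos /= => /path_vertex_inj/addrI[] /val_inj.
by [].
Qed.

Lemma zigzag_set_ord pq : zigzag_set d a0 m pq ->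
  exists l : 'I_m, pq = path_vertex d (a0 + (l : nat)%:Z).
Proof. by move=> [l lm <-]; exists (Ordinal lm). Qed.

Lemma zigzag_sum_thin : thin (zigzag_set d a0 m) B.
Proof.
split=> [pq /zigzag_set_ord[l ->]|pq Spq|p q|p q].
- exact: (quotient_dim0_line (delta_bideg l) (delta_neq0 l)
            (fun z => (bideg_delta l z).1)).
- apply: zbideg_vanish => -[i l] /= e; apply: Spq; rewrite -e /zpos /=.
  by apply/zigzag_set_vertex; have := ltn_ord l; lia.
- move=> /zigzag_set_ord[l el] /zigzag_set_ord[l' el'].
  have [e1 e2] : (l' : nat) = l.+1 /\ ((a0 + (l : nat)%:Z) %% 2)%Z = 0.
    by move: el el'; rewrite /path_vertex => -[? ?] [? ?]; lia.
  rewrite el el'.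
  apply: (set_bij_lines (delta_bideg l') (delta_neq0 l')
            (bideg_delta l) (bideg_delta l')).
  apply/ffunP => -[i l'']; rewrite !ffunE /= (bigID (pred1 l)) /= [X in _ + X]big1 ?addr0.
    rewrite (eq_bigl (fun j => (j == l) && (l'' == l'))); last first.
      move=> j; case: (eqVneq j l) => [->|_]; last by rewrite andbF.
      by rewrite andbT /right_edge e2 -[l'' == l']val_eqE /= e1.
    case: eqP => _.
      by rewrite (eq_bigl (pred1 l)) ?big_pred1_eq ?ffunE ?eqxx // => j; rewrite andbT.
    by rewrite big1 // => j; rewrite andbF.
  by move=> j /andP[_ /negbTE jl]; rewrite ffunE /= jl.
- move=> /zigzag_set_ord[l el] /zigzag_set_ord[l' el'].
  have [e1 e2] : (l : nat) = l'.+1 /\ ((a0 + (l : nat)%:Z) %% 2)%Z = 0.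
    by move: el el'; rewrite /path_vertex => -[? ?] [? ?]; lia.
  rewrite el el'.
  apply: (set_bij_lines (delta_bideg l') (delta_neq0 l')
            (bideg_delta l) (bideg_delta l')).
  apply/ffunP => -[i l'']; rewrite !ffunE /= (bigID (pred1 l)) /= [X in _ + X]big1 ?addr0.
    rewrite (eq_bigl (fun j => (j == l) && (l'' == l'))); last first.
      move=> j; case: (eqVneq j l) => [->|_]; last by rewrite andbF.
      by rewrite andbT /left_edge e2 -[l'' == l']val_eqE /= e1 eqSS eq_sym.
    case: eqP => _.
      by rewrite (eq_bigl (pred1 l)) ?big_pred1_eq ?ffunE ?eqxx // => j; rewrite andbT.
    by rewrite big1 // => j; rewrite andbF.
  by move=> j /andP[_ /negbTE jl]; rewrite ffunE /= jl.
Qed.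

End OneZigzag.

Section Decompose.
Variables (I : finType) (k a : I -> int) (m : nat).
Hypothesis m0 : (0 < m)%N.
Let A := @zigzag_sum R I k a m.
Let B i := @zigzag_sum R unit (fun=> k i) (fun=> a i) m.

Definition zinj i (v : B i) : A :=
  [ffun t => if t.1 == i then v (tt, t.2) else 0].

Lemma zinj_linear i : linear (@zinj i).
Proof.
move=> x u v; apply/ffunP => t; rewrite !ffunE; case: ifP => // _.
by rewrite scaler0 addr0.
Qed.

HB.instance Definition _ i :=
  GRing.isLinear.Build R[i] (B i) A _ (@zinj i) (@zinj_linear i).

Lemma zinj_bideg i pq v : bideg (B i) pq v -> bideg A pq (zinj v).
Proof.
by move=> vB [j l] e; rewrite ffunE /=; case: eqP => // ji; apply: vB; rewrite -ji.
Qed.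

Lemma zinj_zmap i c (v : B i) :
  zinj (zmap (fun=> a i) c v : B i) = zmap a c (zinj v) :> A.
Proof.
apply/ffunP => -[j l]; rewrite !ffunE /=; case: eqP => [->|ji].
  by apply: eq_bigr => l' _; rewrite ffunE eqxx.
by rewrite big1 // => l' _; rewrite ffunE /=; case: eqP.
Qed.

Lemma zigzag_sum_direct (v : A) : exists! x : forall i, B i,
  finite_set [set i | x i != 0] /\ v = \sum_(i \in [set: I]) zinj (x i).
Proof.
have sumE (y : forall i, B i) t : (\sum_(i \in [set: I]) zinj (y i)) t = y t.1 (tt, t.2).
  rewrite (fsum_seq (s := index_enum I)) ?index_enum_uniq //; last first.
    by move=> i; rewrite mem_index_enum.
  rewrite sum_ffunE (bigD1 t.1) //= ffunE eqxx big1 ?addr0 // => i it.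
  by rewrite ffunE eq_sym (negbTE it).
exists (fun i => [ffun t => v (i, t.2)]); split; first split.
- exact: finite_finset.
- by apply/ffunP => -[i l]; rewrite sumE ffunE.
- move=> y [_ vy]; apply: functional_extensionality_dep => i; apply/ffunP => -[[] l].
  by rewrite ffunE vy sumE.
Qed.

(** Kept transparent, since the index type and the summands are computed with below. *)
Definition zigzag_decomposition : decomposition A.
Proof.
apply: (@Decomposition R A I B (fun i => @zinj i : {linear B i -> A})).
- exact: zinj_bideg.
- by move=> i v; apply: zinj_zmap.
- by move=> i v; apply: zinj_zmap.
- exact: zigzag_sum_direct.
- move=> i; right; exists (zigzag_set (k i) (a i) m); split; last exact: zigzag_sum_thin.
  by exists m; split=> //; exists (k i), (a i).
Defined.

End Decompose.
End ZigzagSumTheory.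

(** * Sums of zigzags that are invariant under the reflections *)

Section FormalDecomposition.
Context {R : realType} (I : finType) (k a : I -> int) (m : nat).
Hypothesis m0 : (0 < m)%N.
Let A := @zigzag_sum R I k a m.
Let D : decomposition A := zigzag_decomposition k a m0.

Lemma zigzag_sum_summands S :
  zigzag_summands D S = [set i : I | zigzag_set (k i) (a i) m = S].
Proof.
apply/seteqP; split=> [i [_ tS]|i iS].
  exact: thin_unique (@zigzag_sum_thin R (k i) (a i) m) tS.
rewrite /= in iS; rewrite -{}iS; split; last exact: zigzag_sum_thin.
by exists m; split=> //; exists (k i), (a i).
Qed.

Lemma zigzag_sum_reflect (f : int * int -> int * int) (g : I -> I) S :
  involutive f -> involutive g ->
  (forall i, zigzag_set (k (g i)) (a (g i)) m = f @` zigzag_set (k i) (a i) m) ->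
  zigzag_summands D (f @` S) #= zigzag_summands D S.
Proof.
move=> ff gg fg; rewrite !zigzag_sum_summands.
have fK S' : f @` (f @` S') = S'.
  by rewrite image_comp (_ : f \o f = id) ?image_id //; apply/funext => x /=; rewrite ff.
rewrite (_ : [set i | _ = f @` S] = g @` [set i | zigzag_set (k i) (a i) m = S]).
  by apply: inj_card_eq => i j _ _; exact: (can_inj gg).
apply/seteqP; split=> [i /= iS|_ [i /= iS <-]]; last by rewrite fg iS.
by exists (g i); rewrite ?gg // fg iS fK.
Qed.

Lemma zigzag_sum_bigolin p q r s : uniq s -> (forall i, i \in s) ->
  bigolin_number A p q r =
    Some (count (fun i => zigzag_bit (k i) (a i) (a i + m%:Z - 1) p q r) s).
Proof.
move=> us Hs; apply: (bigolin_number_count (D := D)) us _ _ => i.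
  by rewrite Hs.
exact/zigzag_01/zigzag_sum_thin.
Qed.

(** The transposition sends vertex j of the path of [k] to vertex 2k - j, reversing the path. The
    duality exchanges the two total degrees, so [k] becomes 2n - 1 - k, and it translates vertex
    numbers by 2(n - k) - 1. Keeping the supports off the corners makes the corner condition
    vacuous. *)
Lemma zigzag_sum_DCform n (f g : I -> I) :
  (forall i r s, zigzag_set (k i) (a i) m (r, s) ->
    [&& 0 <= r <= n%:Z, 0 <= s <= n%:Z &
      ~~ (((r == 0) || (r == n%:Z)) && ((s == 0) || (s == n%:Z)))]) ->
  involutive f -> involutive g ->
  (forall i, k (f i) = k i /\ a (f i) = 2 * k i - a i - (m%:Z - 1)) ->
  (forall i, k (g i) = 2 * n%:Z - 1 - k i /\ a (g i) = a i + 2 * (n%:Z - k i) - 1) ->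
  DCform n A.
Proof.
move=> box ff gg fE gE; split.
  move=> p q npq; apply: zbideg_vanish => -[i l] e; apply: npq.
  have : zigzag_set (k i) (a i) m (p, q).
    by rewrite -e; apply/zigzag_set_vertex => /=; have := ltn_ord l; lia.
  by move=> /box; lia.
exists D; split.
- move=> i S [_ tS] [r s] Srs cor.
  rewrite -(thin_unique (@zigzag_sum_thin R (k i) (a i) m) tS) in Srs; have := box _ _ _ Srs.
  by case: cor => [[[]|]|] [-> ->]; rewrite !eqxx ?orbT ?andbF.
- exact: finite_finset.
- move=> S _; apply: (@zigzag_sum_reflect _ f) => // [[r s] //|i].
  have [-> ->] := fE i.
  apply/seteqP; split=> [[r s] /zigzag_setE rs|_ [[r s] /zigzag_setE rs <-]].
    by exists (s, r) => //; apply/zigzag_setE; lia.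
  by apply/zigzag_setE => /=; lia.
- move=> S _; apply: (@zigzag_sum_reflect _ g) => // [[r s]|i].
    by rewrite /duality_refl /=; congr (_, _); lia.
  have [-> ->] := gE i.
  apply/seteqP; split=> [[r s] /zigzag_setE rs|_ [[r s] /zigzag_setE rs <-]].
    exists (n%:Z - s, n%:Z - r); first by apply/zigzag_setE; lia.
    by rewrite /duality_refl /=; congr (_, _); lia.
  by apply/zigzag_setE => /=; lia.
Qed.

End FormalDecomposition.

Section Summands.
Context {R : realType} {A : double_complex R} (D : decomposition A) (i : dec_index D).
Implicit Type v : summand i.

Lemma summand_inj_eq0 v : summand_inj i v = 0 -> v = 0.
Proof. by move=> v0; rewrite -(pr_inj v) v0 linear0. Qed.

Lemma pr_bideg pq u : bideg A pq u -> bideg (summand i) pq (pr i u).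
Proof. by move/bidegE => e; apply/bidegE; rewrite -pr_component e. Qed.

Lemma summand_bideg0 pq : bideg A pq = [set 0] ->
  forall v, bideg (summand i) pq v -> v = 0.
Proof.
by move=> A0 v /summand_inj_bideg; rewrite A0 => /summand_inj_eq0.
Qed.

End Summands.

Lemma thin_in (R : realType) (B : double_complex R) S pq v :
  thin S B -> bideg B pq v -> v != 0 -> S pq.
Proof. by move=> tB vB v0; apply: contrapT => /(thin0 tB)/(_ vB)/eqP; apply/negP. Qed.

Lemma thin_notin (R : realType) (B : double_complex R) S pq :
  thin S B -> (forall v, bideg B pq v -> v = 0) -> ~ S pq.
Proof.
move=> [dimS _ _ _] H /dimS/quotient_dim0_1[e [/H -> /eqP]].
by [].
Qed.

(** * Two complexes with the same Bigolin numbers *)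

Section EvenZigzags.
Context {R : realType}.
Variable n : nat.
Hypothesis n4 : (4 <= n)%N.

(** The bit [i.1] stands for the transposition and [i.2] for the duality. From the zigzag of length
    4 with [k = 3] and start 0, the former gives start 2 * 3 - 0 - 3 = 3, the latter [k] = 2n - 4
    and start 2(n - 3) - 1 = 2n - 7. The last bit in [a2] selects the half. *)
Let k1 (i : bool * bool) : int := if i.2 then 2 * n%:Z - 4 else 3.
Let a1 (i : bool * bool) : int :=
  (if i.1 then 3 else 0) + (if i.2 then 2 * n%:Z - 7 else 0).
Let k2 (i : bool * bool * bool) : int := k1 i.1.
Let a2 (i : bool * bool * bool) : int := a1 i.1 + (if i.2 then 2 else 0).

(* The orbit, under the two reflections, of the zigzag
   (0,3) -> (1,3) <- (1,2) -> (2,2); erasing its middle arrows gives the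
   second complex. *)
Definition long_zigzags := @zigzag_sum R _ k1 a1 4.
Definition short_zigzags := @zigzag_sum R _ k2 a2 2.

Lemma long_zigzags_DCform : DCform n long_zigzags.
Proof.
apply: (@zigzag_sum_DCform R _ k1 a1 4 isT n
  (fun i => (~~ i.1, i.2)) (fun i => (i.1, ~~ i.2))).
- by move=> [[] []] r s /zigzag_setE; rewrite /k1 /a1 /=; lia.
- by move=> [[] []].
- by move=> [[] []].
- by move=> [[] []]; rewrite /k1 /a1 /=; lia.
- by move=> [[] []]; rewrite /k1 /a1 /=; lia.
Qed.

Lemma short_zigzags_DCform : DCform n short_zigzags.
Proof.
(* The transposition reverses the path and hence also exchanges the two halves; the duality
   preserves them. *)
apply: (@zigzag_sum_DCform R _ k2 a2 2 isT n
  (fun i => (~~ i.1.1, i.1.2, ~~ i.2)) (fun i => (i.1.1, ~~ i.1.2, i.2))).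
- by move=> [[[] []] []] r s /zigzag_setE; rewrite /k2 /a2 /k1 /a1 /=; lia.
- by move=> [[[] []] []].
- by move=> [[[] []] []].
- by move=> [[[] []] []]; rewrite /k2 /a2 /k1 /a1 /=; lia.
- by move=> [[[] []] []]; rewrite /k2 /a2 /k1 /a1 /=; lia.
Qed.

Lemma zigzag_bit_split d a p q r :
  (zigzag_bit d a (a + 4%:Z - 1) p q r =
   zigzag_bit d a (a + 2%:Z - 1) p q r +
   zigzag_bit d (a + 2) (a + 2 + 2%:Z - 1) p q r :> nat)%N.
Proof.
rewrite /zigzag_bit; case: ifP => H1; case: ifP => H2; case: ifP => H3;
  case: ifP => H4; case: ifP => H5; lia.
Qed.

Lemma long_short_bigolin : same_bigolin_numbers long_zigzags short_zigzags.
Proof.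
move=> p q r; pose s := [:: (false, false); (false, true); (true, false); (true, true)].
pose s' := [seq (i, b) | i <- s, b <- [:: false; true]].
rewrite (@zigzag_sum_bigolin _ _ k1 a1 4 isT p q r s) => [||[[] []]] //.
rewrite (@zigzag_sum_bigolin _ _ k2 a2 2 isT p q r s') => [||[[[] []] []]] //.
by rewrite /= /k2 /a2 /= !zigzag_bit_split !addr0; congr Some; lia.
Qed.

Lemma long_del_delbar (u : long_zigzags) : bideg long_zigzags (0, 3) u ->
  exists2 y, bideg long_zigzags (1, 2) y & del long_zigzags u = delbar long_zigzags y.
Proof.
pose i0 := (false, false); move=> uB.
(* Bidegree (0, 3) occurs only as the first vertex of the unreflected zigzag. *)
have u0 t : t != (i0, ord0) -> u t = 0.
  move=> tn; apply: uB; move: t tn => [[[] []] l];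
    rewrite /zpos /k1 /a1 /path_vertex /=; last first.
    by rewrite xpair_eqE eqxx -val_eqE /= => ln []; lia.
  1-3: by move=> _ []; lia.
(* Vertex 2 of the same zigzag is (1, 2). Its [delbar] and the [del] of vertex 0 both hit vertex 1
   with coefficient 1, so the coefficient is copied. *)
exists [ffun t => if t == (i0, inord 2) then u (i0, ord0) else 0].
  move=> t; rewrite ffunE; case: eqP => // ->; rewrite /zpos /k1 /a1 /path_vertex /=.
  by rewrite inordK.
apply/ffunP => -[i l]; rewrite !ffunE /=; case: (eqVneq i i0) => [->|ii]; last first.
  rewrite !big1 // => l' _; last by rewrite u0 // xpair_eqE (negbTE ii).
  by rewrite ffunE xpair_eqE (negbTE ii).
rewrite big_mkcond [RHS]big_mkcond (bigD1 ord0) //= [RHS](bigD1 (inord 2)) //=.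
rewrite !big1 => [|l' ll'|l' ll']; last 2 first.
- by case: ifP => // _; rewrite ffunE xpair_eqE (negbTE ll') andbF.
- by case: ifP => // _; rewrite u0 // xpair_eqE (negbTE ll') andbF.
by rewrite !addr0 ffunE eqxx /right_edge /left_edge inordK //= eqSS eq_sym.
Qed.

(** In such a summand a generator at (0, 3) would have a nonzero image under [del]. By
    [long_del_delbar], this image is [delbar] of a projected element of bidegree (1, 2), where the
    summand is zero. *)
Lemma long_zigzag_summand (D : decomposition long_zigzags) i :
  ~ is_zigzag (zigzag_set 3 0 2) (@summand _ _ D i).
Proof.
move=> [_ tS]; have [dimS _ _ _] := tS.
have S03 : zigzag_set 3 0 2 (0, 3) by apply/zigzag_setE; lia.
have S13 : zigzag_set 3 0 2 (0 + 1, 3) by apply/zigzag_setE; lia.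
have [e [eB /eqP e0 _]] := quotient_dim0_1 (dimS _ S03).
apply: e0; apply: (thin_del_inj tS S03 S13 eB).
have [y yB dy] := long_del_delbar (summand_inj_bideg eB).
rewrite -[LHS]pr_inj summand_inj_del dy pr_delbar.
rewrite (thin0 tS _ (pr_bideg i yB)) ?linear0 // => /zigzag_setE; lia.
Qed.

Lemma short_del_neq0 (u : short_zigzags) : bideg short_zigzags (0, 3) u ->
  u != 0 -> del short_zigzags u != 0.
Proof.
pose i0 := (false, false, false); move=> uB.
have u0 t : t != (i0, ord0) -> u t = 0.
  move=> tn; apply: uB; move: t tn => [[[[] []] []] l];
    rewrite /zpos /k2 /a2 /k1 /a1 /path_vertex /=; last first.
    by rewrite xpair_eqE eqxx -val_eqE /= => ln []; lia.
  1-7: by move=> _ []; lia.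
apply: contra_neq => /ffunP/(_ (i0, inord 1)); rewrite !ffunE /= inordK //.
rewrite big_mkcond (bigD1 ord0) //= big1 ?addr0 => [ut|l' ll']; last first.
  by case: ifP => // _; rewrite u0 // xpair_eqE (negbTE ll') andbF.
apply/ffunP => t; rewrite ffunE; case: (eqVneq t (i0, ord0)) => [->|/u0 //].
exact: ut.
Qed.

Lemma short_delbar0 (v : short_zigzags) : bideg short_zigzags (1, 2) v ->
  delbar short_zigzags v = 0.
Proof.
move=> vB; apply/ffunP => -[i l]; rewrite !ffunE big1 //= => l' /andP[par /eqP ll'].
apply: vB; have := ltn_ord l'; move: par ll'.
rewrite /zpos /path_vertex /k2 /a2 /k1 /a1 /=.
by move: i => [[[] []] []] /= par ll' l2 []; lia.
Qed.

Lemma short_bideg0 p : p = 2 \/ p = 4 -> bideg short_zigzags (0, p) = [set 0].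
Proof.
move=> pE; apply: zbideg_vanish => -[i l]; have := ltn_ord l.
rewrite /zpos /path_vertex /k2 /a2 /k1 /a1 /=.
by move: i => [[[] []] []] /= ll []; lia.
Qed.

(** A summand onto which [x0] projects nontrivially contains (0, 3) and (1, 3). It avoids (0, 2) and
    (0, 4), which excludes squares. Since [delbar] vanishes on bidegree (1, 2), a zigzag cannot
    continue there either, and (0, 3), (1, 3) are its only vertices. *)
Lemma short_zigzag_summand (D : decomposition short_zigzags) :
  exists i, is_zigzag (zigzag_set 3 0 2) (@summand _ _ D i).
Proof.
pose x0 : short_zigzags := [ffun t => (t == ((false, false, false), ord0))%:R].
have x0n0 : x0 != 0.
  apply/eqP => /ffunP/(_ ((false, false, false), ord0)); rewrite !ffunE eqxx => /eqP.
  by rewrite oner_eq0.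
have x0B : bideg short_zigzags (0, 3) x0.
  by move=> t; rewrite ffunE; case: eqP => // ->; rewrite /zpos /k2 /a2 /k1 /a1.
have [i wn0] : exists i, pr (D := D) i x0 != 0.
  apply: contrapT => H; case/eqP: x0n0; apply: (pr_ext (D := D)) => i; rewrite linear0.
  by apply/eqP; apply: contrapT => /negP wi; apply: H; exists i.
set w := pr i x0 in wn0.
have wB : bideg (summand i) (0, 3) w by exact: pr_bideg.
have dwn0 : del (summand i) w != 0.
  have : summand_inj i w != 0 by apply: contra_neq wn0 => /summand_inj_eq0.
  move/(short_del_neq0 (summand_inj_bideg wB)); rewrite -summand_inj_del.
  by apply: contra_neq => ->; rewrite linear0.
have dwB : bideg (summand i) (1, 3) (del (summand i) w) by exact: (del_bideg wB).
have B02 := summand_bideg0 (D := D) (i := i) (short_bideg0 (or_introl erefl)).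
have B04 := summand_bideg0 (D := D) (i := i) (short_bideg0 (or_intror erefl)).
exists i; case: (summand_elementary i) => [[a [b tB]]|[S [[m [m0 [d [a E]]]] tB]]].
  have S03 := thin_in tB wB wn0.
  have S02 := thin_notin tB B02; have S04 := thin_notin tB B04.
  have [ea [eb|eb]] : (a = 0 \/ a = - 1) /\ (b = 3 \/ b = 2).
    by case: S03 => [[[]|]|] [e1 e2]; lia.
    case: S04; move: ea => [->|->]; rewrite eb.
      by left; right.
    by right.
  case: S02; move: ea => [->|->]; rewrite eb.
    by left; left; left.
  by left; left; right.
have {}E : S = zigzag_set d a m := E; rewrite {}E in tB.
have S03 := thin_in tB wB wn0; have S13 := thin_in tB dwB dwn0.
have S04 := thin_notin tB B04.
have S12 : ~ zigzag_set d a m (1, 2).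
  move=> S12; have [v vB dv] := thin_delbar_surj tB S12 S13 dwB.
  case/eqP: dwn0; rewrite -dv; apply: summand_inj_eq0; rewrite summand_inj_delbar.
  exact/short_delbar0/summand_inj_bideg.
rewrite (_ : zigzag_set 3 0 2 = zigzag_set d a m).
  by split=> //; exists m; split=> //; exists d, a.
move: S03 S13 S04 S12; rewrite !zigzag_setE => S03 S13 S04 S12.
by apply/seteqP; split=> [[r s]|[r s]] /zigzag_setE rs; apply/zigzag_setE; lia.
Qed.

End EvenZigzags.

Theorem theorem1p3 (R : realType) :
  (forall (A1 A2 : double_complex R),
     bounded A1 -> bounded A2 ->
     forall (D1 : decomposition A1) (D2 : decomposition A2),
     finitely_many_zigzags D1 -> finitely_many_zigzags D2 ->
     same_bigolin_numbers A1 A2 ->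
     forall S : set (int * int), odd_support S ->
     zigzag_summands D1 S #= zigzag_summands D2 S)
  /\
  (forall n : nat, (4 <= n)%N ->
     exists A1 A2 : double_complex R,
       [/\ DCform n A1, DCform n A2, same_bigolin_numbers A1 A2 &
           exists2 S : set (int * int), even_support S &
           forall (D1 : decomposition A1) (D2 : decomposition A2),
             ~ (zigzag_summands D1 S #= zigzag_summands D2 S)]).
Proof.
split=> [A1 A2 _ _ D1 D2|n n4]; first exact: odd_multiplicities.
exists (long_zigzags n), (short_zigzags n); split.
- exact: long_zigzags_DCform.
- exact: short_zigzags_DCform.
- exact: long_short_bigolin.
(* The support is (0, 3), (1, 3): its multiplicity is zero in every decomposition of the first
   complex and nonzero in every decomposition of the second. *)
exists (zigzag_set 3 0 2); first by exists 2%N => //; split=> //; exists 3, 0.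
move=> D1 D2; have [i iS] := short_zigzag_summand n4 D2.
have -> : zigzag_summands D1 (zigzag_set 3 0 2) = set0.
  by apply/seteqP; split=> // j /(long_zigzag_summand n4).
rewrite card_eq_sym card_eq0 => /eqP e.
by have : (zigzag_summands D2 (zigzag_set 3 0 2)) i := iS; rewrite e.
Qed.
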